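(* Let $2\le n\in\mathbb{N}$, let $\Omega\subset\mathbb{R}^n$ be a bounded domain with smooth boundary $\partial\Omega$ such that $\Omega$ lies on one side of $\partial\Omega$, and let $2\le m\in\mathbb{N}$. Let $d_1,\dots,d_m>0$ and assume: (INIT) $v=(v_i)\in C(\overline\Omega,\mathbb{R}_+^m)$. (F) $f=(f_i):\mathbb{R}^m\to\mathbb{R}^m$ is locally Lipschitz, i.e. there is $C\in C(\mathbb{R}^m\times\mathbb{R}^m,\mathbb{R}_+)$ with $|f(u)-f(w)|\le C(u,w)|u-w|$ for all $u,w\in\mathbb{R}^m$. (QP) For each $i\in\{1,\dots,m\}$, $f_i(u)\ge0$ whenever $u\in\mathbb{R}_+^m$ with $u_i=0$. (INT-SUM) There are a lower triangular $m\times m$ matrix $A=(a_{i,j})$ with $a_{i,i}=1$ for all $i$ and positive entries below the diagonal, and $L>0$, such that for all $k=1,\dots,m$, $\sum_{j=1}^k a_{k,j}f_j(u)\le L\left(\sum_{i=1}^m u_i+1\right)$ for all $u\in\mathbb{R}_+^m$. Let $p\in\mathbb{N}$ with $p\ge2$. Then there exists $L_p\in C(\mathbb{R}_+,\mathbb{R}_+)$ such that for every kernel $\varphi\in C(\overline\Omega\times\overline\Omega,\mathbb{R}_+)$ satisfying $\varphi(x,y)=\varphi(y,x)$ for all $x,y\in\Omega$ and, for some $\varepsilon,\mu\ge0$, $0\le\varepsilon\le\int_\Omega\varphi(x,y)\,dy\le\mu$ for all $x\in\Omega$, the unique component-wise nonnegative global classical solution $u$ of $$\begin{cases}\dfrac{\partial}{\partial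 t}u_i(x,t)=\displaystyle\int_\Omega d_i\varphi(x,y)\,(u_i(y,t)-u_i(x,t))\,dy+f_i(u(x,t)), & x\in\Omega,\ t\ge0,\ i=1,\dots,m,\\ u_i(x,0)=v_i(x), & x\in\Omega,\ i=1,\dots,m,\end{cases}$$ satisfies $$\|u(\cdot,t)\|_{p,\Omega}\le L_p(t)\quad\text{for all }t\ge0.$$ (In particular $L_p$ is independent of the choice of $\varphi$.)
   Context: $\mathbb{R}_+^m=\{z\in\mathbb{R}^m: z_i\ge0 \text{ for all } i\}$ and $\mathbb{R}_+=[0,\infty)$. $\|\cdot\|_{p,\Omega}$ is the $L^p(\Omega)$ norm (for vector-valued functions, $L^p(\Omega,\mathbb{R}^m)$). A global classical solution is a function whose components are continuous on $\overline\Omega\times[0,\infty)$ together with their first-order $t$-derivative and which satisfies the system for all $t\ge0$. Under the stated hypotheses such a component-wise nonnegative solution exists and is unique. *)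

(* Defs.v *)
From HB Require Import structures.
From mathcomp Require Import all_boot all_order all_algebra.
From mathcomp Require Import all_classical all_reals all_analysis.
From mathcomp Require Import ring lra.
Set Implicit Arguments.
Unset Strict Implicit.
Unset Printing Implicit Defensive.
Import Order.TTheory GRing.Theory Num.Theory.
Import numFieldNormedType.Exports.
Local Open Scope classical_set_scope.
Local Open Scope ring_scope.

Definition rV_display : measure_display.
Proof. exact: default_measure_display. Qed.

Section borel_rV.
Context {R : realType} {n : nat}.

Let rV_borel : set (set 'rV[R]_n) := <<s open >>.

Let rV_borel0 : rV_borel set0. Proof. exact: sigma_algebra0. Qed.
Let rV_borelC A : rV_borel A -> rV_borel (~` A).
Proof. exact: sigma_algebraC. Qed.
Let rV_borel_bigcup (F : (set 'rV[R]_n)^nat) :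
  (forall i, rV_borel (F i)) -> rV_borel (\bigcup_i F i).
Proof. exact: sigma_algebra_bigcup. Qed.

HB.instance Definition _ := @isMeasurable.Build rV_display 'rV[R]_n
  rV_borel rV_borel0 rV_borelC rV_borel_bigcup.
End borel_rV.

Lemma open_rV_measurable (R : realType) n (A : set 'rV[R]_n) :
  open A -> measurable A.
Proof. by move=> oA; exact: sub_gen_smallest. Qed.

Lemma measurable_coord_rV (R : realType) n (i : 'I_n) :
  measurable_fun [set: 'rV[R]_n]
    (fun x : 'rV[R]_n => (x ord0 i : measurableTypeR R)).
Proof.
apply: (measurability _ (measurable_realfun.RGenOpens.measurableE R)).
move=> _ [_ [a [b ->] <-]]; rewrite setTI; apply: open_rV_measurable.
apply: open_comp; last exact: interval_open.
by move=> x _; exact: coord_continuous.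
Qed.

Lemma open_prod_rV_measurable (R : realType) n
    (W : set (measurableTypeR R * 'rV[R]_n)) :
  open (W : set (R * 'rV[R]_n)) -> measurable W.
Proof.
move=> oW.
pose B (t : rat * 'rV[rat]_n * nat) : set (measurableTypeR R * 'rV[R]_n) :=
  ball (ratr t.1.1 : R) t.2.+1%:R^-1 `*`
  ball (map_mx ratr t.1.2 : 'rV[R]_n) t.2.+1%:R^-1.
pose F t := if `[< B t `<=` W >] then B t else set0.
have -> : W = \bigcup_t F t.
  apply/seteqP; split=> [[x y] Wxy|z [t _]]; last first.
    by rewrite /F; case: asboolP => [BW /BW|].
  have /nbhs_ballP[e /= e0 eW] := open_nbhs_nbhs (conj oW Wxy).
  have [k _ ke] : exists2 k, True & 2 * k.+1%:R^-1 < e.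
    exists (Num.truncn (2 / e)) => //.
    rewrite ltr_pdivrMr// mulrC -ltr_pdivrMr//.
    exact: truncnS_gt.
  pose r : R := k.+1%:R^-1.
  have r0 : 0 < r by rewrite invr_gt0.
  have approx (a : R) : exists q : rat, ball (ratr q : R) r a.
    have [q] := @rat_in_itvoo R (a - r) (a + r) 
      ltac:(rewrite ltrBlDr -addrA ltrDl addr_gt0//).
    rewrite in_itv/= => /andP[aq qa]; exists q.
    by rewrite /ball/= ltr_norml; apply/andP; split; lra.
  have [q qP] := choice approx.
  have close (c x1 x2 : R) : ball c r x1 -> ball c r x2 -> ball x1 e x2.
    rewrite /ball/= => c1 c2; apply: lt_trans ke.
    have -> : x1 - x2 = (c - x2) - (c - x1) by ring.
    by apply: le_lt_trans (ler_normB _ _) _; rewrite mulr_natl mulr2n ltrD.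
  exists ((q x, \row_j q (y ord0 j)), k) => //; rewrite /F.
  case: asboolP => [_|[]].
    by split => //=; split => [//|i j]; rewrite !mxE (ord1 i).
  move=> [x' y'] [/= bx [_ by_]]; apply: eW; split => /=.
    exact: close bx.
  split => // i j; have := by_ i j; rewrite !mxE (ord1 i).
  exact: close.
apply: countable_bigcupT_measurable => [|t]; first exact: countableP.
rewrite /F; case: asboolP => _ //; apply: measurableX.
  by apply: measurable_realfun.open_measurable; exact: ball_open.
apply: open_rV_measurable; exact: ball_open.
Qed.

(* The identification of R x R^n with R^(n+1). *)
Definition cons_rV (R : realType) n (z : measurableTypeR R * 'rV[R]_n) :
    'rV[R]_n.+1 :=
  row_mx (z.1)%:M z.2 : 'rV[R]_(1 + n).

Lemma cons_rVE0 (R : realType) n (z : measurableTypeR R * 'rV[R]_n) :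
  cons_rV z ord0 ord0 = z.1.
Proof.
have -> : ord0 = lshift n ord0 :> 'I_(1 + n) by exact/val_inj.
by rewrite [LHS](row_mxEl (z.1)%:M z.2) mxE eqxx.
Qed.

Lemma cons_rVES (R : realType) n (z : measurableTypeR R * 'rV[R]_n) i :
  cons_rV z ord0 (lift ord0 i) = z.2 ord0 i.
Proof.
have -> : lift ord0 i = rshift 1 i :> 'I_(1 + n) by exact/val_inj.
by rewrite [LHS](row_mxEr (z.1)%:M z.2).
Qed.

Lemma measurable_cons_rV (R : realType) n :
  measurable_fun setT (@cons_rV R n).
Proof.
apply: (@measurability _ _ _ _ setT (@cons_rV R n) (@open _) erefl) => //.
move=> _ [V oV <-]; rewrite setTI.
apply: open_prod_rV_measurable.
apply: open_comp oV => z _ A [P Pz PA].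
pose Q : set 'rV[R]_n := [set y | forall j, P ord0 (lift ord0 j) (y ord0 j)].
have : nbhs z (P ord0 ord0 `*` Q).
  exists (P ord0 ord0, Q) => //=; split.
    by have := Pz ord0 ord0; rewrite cons_rVE0.
  exists (fun _ (j : 'I_n) => P ord0 (lift ord0 j)) => [i j|y yP j].
    by have := Pz ord0 (lift ord0 j); rewrite cons_rVES (ord1 i).
  exact: (yP ord0 j).
apply: filterS => -[x y] [/= Px Qy]; apply: PA => i j; rewrite (ord1 i).
case: (unliftP ord0 j) => [k|] ->; first by rewrite cons_rVES; exact: Qy.
by rewrite cons_rVE0.
Qed.

(* Lebesgue measure on the Borel sets of R^n, as an iterated product measure;
   lebesgue_rV_box below gives its value on boxes. *)
Fixpoint lebesgue_rV (R : realType) (n : nat) : set 'rV[R]_n -> \bar R :=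
  match n with
  | 0 => \d_(0 : 'rV[R]_0)
  | n'.+1 => pushforward (@lebesgue_measure R \x @lebesgue_rV R n')%E
               (@cons_rV R n')
  end.
Section lebesgue_rV_measure.
Local Open Scope ereal_scope.
Variable R : realType.

Let is_sfm n (mu : set 'rV[R]_n -> \bar R) :=
  [/\ mu set0 = 0, forall A, 0 <= mu A, semi_sigma_additive mu &
   forall A : 'I_n -> set (measurableTypeR R),
     (forall i, measurable (A i)) ->
     mu [set x | forall i, A i (x ord0 i)] =
     \prod_(i < n) lebesgue_measure (A i)].

Let box_measurable n (A : 'I_n -> set (measurableTypeR R)) :
  (forall i, measurable (A i)) ->
  measurable [set x : 'rV[R]_n | forall i, A i (x ord0 i)].
Proof.
move=> mA.
have -> : [set x : 'rV[R]_n | forall i, A i (x ord0 i)] =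
          \bigcap_(i in [set: 'I_n]) ((fun x : 'rV[R]_n => x ord0 i) @^-1` A i).
  by apply/seteqP; split=> [x xA i _|x xA i]; exact: xA.
apply: fin_bigcap_measurable => // i _; rewrite -[X in measurable X]setTI.
exact: measurable_coord_rV.
Qed.

Let is_sfm_sigma_finite n mu : @is_sfm n mu -> sigma_finite setT mu.
Proof.
move=> [_ _ _ muE]; pose A k (i : 'I_n) : set (measurableTypeR R) :=
  `[(- k%:R)%R, k%:R%R]%classic.
have mA k i : measurable (A k i) by exact: measurable_itv.
exists (fun k => [set x : 'rV[R]_n | forall i, A k i (x ord0 i)]).
  apply/seteqP; split=> // x _; pose k := Num.bound `|x|%R.
  exists k => // i; rewrite /A/= in_itv/= -ler_norml.
  apply: le_trans (ltW (archi_boundP _)) => //.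
  rewrite [leRHS]/Num.norm/= mx_normrE.
  by apply/bigmax_geP; right => /=; exists (ord0, i).
move=> k; split; first exact: box_measurable.
rewrite muE// -ge0_fin_numE; last first.
  by apply: prode_ge0 => i _; exact: measure_ge0.
apply: prode_fin_num => i _; rewrite lebesgue_measure_itv/=.
by case: ifPn => // _; rewrite -EFinB.
Qed.

Let lebesgue_rV_sfm n : is_sfm (@lebesgue_rV R n).
Proof.
elim: n => [|n IH].
  split => //=.
  - exact: measure_semi_sigma_additive.
  - move=> A _; rewrite big_ord0 diracE mem_set// => -[]//.
have [mu0 mu_ge0 muU muE] := IH.
pose H1 := isMeasure.Build _ _ _ (@lebesgue_rV R n) mu0 mu_ge0 muU.
pose H2 := isSigmaFinite.Build _ _ _ _ (is_sfm_sigma_finite IH).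
pose m0 : {measure set 'rV[R]_n -> \bar R} :=
  HB.pack_for {measure set 'rV[R]_n -> \bar R} (@lebesgue_rV R n) H1.
pose H3 := isSFinite.Build _ _ _ (@lebesgue_rV R n)
  (@sfinite_measure_sigma_finite _ _ _ m0 (is_sfm_sigma_finite IH)).
pose mu : {sigma_finite_measure set 'rV[R]_n -> \bar R} :=
  HB.pack_for {sigma_finite_measure set 'rV[R]_n -> \bar R}
    (@lebesgue_rV R n) H1 H3 H2.
pose nu : {measure set _ -> \bar R} := (@lebesgue_measure R \x mu).
have nuE : @lebesgue_rV R n.+1 = pushforward nu (@cons_rV R n) by [].
have mf := @measurable_cons_rV R n.
rewrite nuE; split.
- by rewrite /pushforward preimage_set0 measure0.
- by move=> A; exact: measure_ge0.
- move=> F mF tF mUF; rewrite /pushforward preimage_bigcup.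
  apply: measure_semi_sigma_additive.
  + by move=> i; rewrite -[X in measurable X]setTI; exact: mf.
  + apply/trivIsetP => /= i j _ _ ij; rewrite -preimage_setI.
    by move/trivIsetP : tF => /(_ _ _ _ _ ij) ->//; rewrite preimage_set0.
  + by rewrite -preimage_bigcup -[X in measurable X]setTI; exact: mf.
- move=> A mA; rewrite /pushforward.
  have -> : @cons_rV R n @^-1` [set x | forall i, A i (x ord0 i)] =
     A ord0 `*` [set x : 'rV[R]_n | forall i : 'I_n,
       A (lift ord0 i) (x ord0 i)].
    apply/seteqP; split=> [z Az|z [z1 z2] i] /=.
      split=> [|i]; first by have := Az ord0; rewrite cons_rVE0.
      by have := Az (lift ord0 i); rewrite cons_rVES.
    case: (unliftP ord0 i) => [k|] ->; first by rewrite cons_rVES; exact: z2.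
    by rewrite cons_rVE0.
  rewrite big_ord_recl -muE//.
  apply: (@product_measure1E _ _ _ _ R lebesgue_measure mu) => //.
  exact: (@box_measurable n (fun i => A (lift ord0 i))) (fun i => mA _).
Qed.

Let lebesgue_rV0 n : @lebesgue_rV R n set0 = 0.
Proof. by have [] := lebesgue_rV_sfm n. Qed.

Let lebesgue_rV_ge0 n A : 0 <= @lebesgue_rV R n A.
Proof. by have [] := lebesgue_rV_sfm n. Qed.

Let lebesgue_rV_additive n : semi_sigma_additive (@lebesgue_rV R n).
Proof. by have [] := lebesgue_rV_sfm n. Qed.

HB.instance Definition _ n := isMeasure.Build _ _ _ (@lebesgue_rV R n)
  (lebesgue_rV0 n) (lebesgue_rV_ge0 (n:=n)) (lebesgue_rV_additive (n:=n)).

HB.instance Definition _ n := Measure_isSigmaFinite.Build _ _ _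
  (@lebesgue_rV R n) (is_sfm_sigma_finite (lebesgue_rV_sfm n)).

Lemma lebesgue_rV_box n (A : 'I_n -> set (measurableTypeR R)) :
  (forall i, measurable (A i)) ->
  lebesgue_rV [set x : 'rV[R]_n | forall i, A i (x ord0 i)] =
  \prod_(i < n) lebesgue_measure (A i).
Proof. by have [_ _ _] := lebesgue_rV_sfm n; exact. Qed.

End lebesgue_rV_measure.

Section definitions.
Variable R : realType.

Definition boundary (T : topologicalType) (A : set T) : set T :=
  closure A `\` A°.

(* C^oo on R^N: partial derivatives of all orders exist and are continuous. *)
Fixpoint iter_partial N (s : seq 'I_N) (g : 'rV[R]_N -> R) : 'rV[R]_N -> R :=
  if s is i :: s' then fun x => 'D_(delta_mx ord0 i) (iter_partial s' g) x
  else g.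

Definition smooth N (g : 'rV[R]_N -> R) : Prop :=
  forall s : seq 'I_N, continuous (iter_partial s g) /\
    forall i x, derivable (iter_partial s g) x (delta_mx ord0 i).

(* Near each boundary point, after relabelling and reorienting the axes (the
   k-th coordinate with sign s is the last one), Omega is exactly the part
   strictly above the graph of a smooth function of the other coordinates; in
   particular Omega lies on one side of its boundary. *)
Definition smooth_boundary n (Omega : set 'rV[R]_n) : Prop :=
  forall x0, boundary Omega x0 ->
  exists (r : R) (k : 'I_n) (s : bool) (gamma : 'rV[R]_n.-1 -> R),
    [/\ 0 < r, smooth gamma &
      Omega `&` ball x0 r =
      [set x | gamma (col' k x) < (-1) ^+ s * x ord0 k] `&` ball x0 r].

Definition bounded_smooth_domain n (Omega : set 'rV[R]_n) : Prop :=
  [/\ Omega !=set0, open Omega, connected Omega, bounded_set Omega &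
      smooth_boundary Omega].

Definition orthant m : set 'rV[R]_m := [set z | forall i, 0 <= z ord0 i].

(* Euclidean norm; the norm `| _ | of 'rV[R]_m is the sup norm. *)
Definition enorm m (z : 'rV[R]_m) : R := Num.sqrt (\sum_i z ord0 i ^+ 2).

Definition Lp_norm n m (Omega : set 'rV[R]_n) (p : nat)
    (w : 'rV[R]_n -> 'rV[R]_m) : \bar R :=
  Lnorm (@lebesgue_rV R n) p%:R%:E ((fun x => (enorm (w x))%:E) \_ Omega).

Definition locally_lipschitz m (f : 'rV[R]_m -> 'rV[R]_m) : Prop :=
  exists C : 'rV[R]_m * 'rV[R]_m -> R,
    [/\ continuous C, forall z, 0 <= C z &
        forall u w, enorm (f u - f w) <= C (u, w) * enorm (u - w)].

Definition quasi_positive m (f : 'rV[R]_m -> 'rV[R]_m) : Prop :=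
  forall i u, orthant u -> u ord0 i = 0 -> 0 <= f u ord0 i.

Definition intermediate_sums m (f : 'rV[R]_m -> 'rV[R]_m)
    (A : 'M[R]_m) (L : R) : Prop :=
  [/\ forall i j : 'I_m, (i < j)%N -> A i j = 0,
      forall i : 'I_m, A i i = 1,
      forall i j : 'I_m, (j < i)%N -> 0 < A i j,
      0 < L &
      forall (k : 'I_m) u, orthant u ->
        \sum_(j < m | (j <= k)%N) A k j * f u ord0 j
          <= L * (\sum_i u ord0 i + 1)].

Definition admissible_kernel n (Omega : set 'rV[R]_n)
    (phi : 'rV[R]_n -> 'rV[R]_n -> R) (eps mu : R) : Prop :=
  [/\ {within closure Omega `*` closure Omega,
         continuous (fun z : 'rV[R]_n * 'rV[R]_n => phi z.1 z.2)},
      forall x y, closure Omega x -> closure Omega y -> 0 <= phi x y,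
      forall x y, Omega x -> Omega y -> phi x y = phi y x,
      0 <= eps /\ 0 <= mu &
      forall x, Omega x ->
        (eps%:E <= \int[@lebesgue_rV R n]_(y in Omega) (phi x y)%:E
                <= mu%:E)%E].

(* l is the derivative at t of g restricted to [0, +oo[ (one-sided at 0). *)
Definition is_derive_ge0 (g : R -> R) (t l : R) : Prop :=
  (g s - g t) / (s - t) @[s --> within `[0, +oo[ t^'] --> l.

(* ut is the t-derivative of u, required to exist and be continuous up to the
   boundary; the equation and the initial condition are imposed on Omega. *)
Definition global_classical_solution n m (Omega : set 'rV[R]_n)
    (d : 'I_m -> R) (phi : 'rV[R]_n -> 'rV[R]_n -> R)
    (f : 'rV[R]_m -> 'rV[R]_m) (v : 'rV[R]_n -> 'rV[R]_m)
    (u : 'rV[R]_n -> R -> 'rV[R]_m) : Prop :=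
  exists ut : 'rV[R]_n -> R -> 'rV[R]_m,
  [/\ forall i, {within closure Omega `*` `[0, +oo[,
        continuous (fun z : 'rV[R]_n * R => u z.1 z.2 ord0 i)},
      forall i, {within closure Omega `*` `[0, +oo[,
        continuous (fun z : 'rV[R]_n * R => ut z.1 z.2 ord0 i)},
      forall i x t, closure Omega x -> 0 <= t ->
        is_derive_ge0 (fun s => u x s ord0 i) t (ut x t ord0 i),
      forall i x t, Omega x -> 0 <= t ->
        ut x t ord0 i =
        \int[@lebesgue_rV R n]_(y in Omega)
          (d i * phi x y * (u y t ord0 i - u x t ord0 i))
        + f (u x t) ord0 i &
      forall i x, Omega x -> u x 0 ord0 i = v x ord0 i].

End definitions.

(* Main.v *)
Require Import Defs.
From HB Require Import structures.
From mathcomp Require Import all_boot all_order all_algebra.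
From mathcomp Require Import all_classical all_reals all_analysis.
From mathcomp Require Import measurable_realfun.
From mathcomp Require Import ring lra.
Set Implicit Arguments.
Unset Strict Implicit.
Unset Printing Implicit Defensive.
Import Order.TTheory GRing.Theory Num.Theory.
Import numFieldNormedType.Exports.
Local Open Scope classical_set_scope.
Local Open Scope ring_scope.

(**
The proof is an L^p energy estimate. For weights theta_i >= 1 put
  H(u) = sum over |beta| = p of binom(p, beta) theta^(beta^2) u^beta,
the diagonal value of a symmetric p-linear form. If the theta_i are large, the
matrix (d_i H_ij) is positive on the orthant, so z |-> (d_i H_i(z))_i is
monotone there; by the symmetry of phi, the diffusion term then contributes
  -1/2 int int phi(x, y) <D (grad H(u(y)) - grad H(u(x))), u(y) - u(x)> <= 0.
If moreover theta_j dominates the powers of theta_k for all k > j, the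
coefficients of the f_j in grad H . f are nonnegative combinations of the rows
of A, and (INT-SUM) gives grad H(u) . f(u) <= C (H(u) + 1). Gronwall's
inequality for int H(u) + |Omega| ends the proof, with constants independent of
phi.
*)

(** * The weighted symmetric form *)

Definition bump_at m (b : 'I_m -> nat) (i : 'I_m) : 'I_m -> nat :=
  fun j => (b j + (j == i))%N.

Lemma bump_atC m (b : 'I_m -> nat) i j :
  bump_at (bump_at b i) j = bump_at (bump_at b j) i.
Proof. by apply/funext => k; rewrite /bump_at addnAC. Qed.

Section weighted_form.
Context {R : realType} {m : nat}.
Variable theta : 'I_m -> R.
Implicit Types (b : 'I_m -> nat) (z h x y F : 'rV[R]_m) (l : seq 'rV[R]_m).

Definition weight b i : R := theta i ^+ (2 * b i + 1).

(* [wform (fun=> 0) (nseq p u)] is the energy H(u), theta^(beta^2) being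
   accumulated factor by factor: theta^((k+1)^2) = theta^(k^2) theta^(2k+1). *)
Fixpoint wform b l : R :=
  if l is z :: l' then \sum_i weight b i * z ord0 i * wform (bump_at b i) l'
  else 1.

(** The weight accumulated along a chain of increments does not depend on their order: for [i != j]
    they touch different coordinates. The symmetry of [wform] rests on this. *)
Lemma weight_bumpC b i j :
  weight b i * weight (bump_at b i) j = weight b j * weight (bump_at b j) i.
Proof.
have [->//|ij] := eqVneq i j.
rewrite /weight /bump_at [j == i]eq_sym (negbTE ij) !addn0.
by rewrite mulrC.
Qed.

(** Since [b] is arbitrary, the exchange also applies deeper in the list, and adjacent
    transpositions generate the full symmetry of the form. *)
Lemma wform_swap b z1 z2 l : wform b (z1 :: z2 :: l) = wform b (z2 :: z1 :: l).
Proof.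
rewrite /=; under eq_bigr do rewrite big_distrr/=.
under [RHS]eq_bigr do rewrite big_distrr/=.
rewrite exchange_big/=; apply: eq_bigr => i _; apply: eq_bigr => j _.
rewrite bump_atC !mulrA; congr (_ * _).
have /(congr1 ( *%R (z1 ord0 j * z2 ord0 i))) := weight_bumpC b i j; lra.
Qed.

Lemma wformD b z1 z2 l :
  wform b ((z1 + z2) :: l) = wform b (z1 :: l) + wform b (z2 :: l).
Proof.
by rewrite /= -big_split/=; apply: eq_bigr => i _; rewrite !mxE; ring.
Qed.

Lemma wformN b z l : wform b ((- z) :: l) = - wform b (z :: l).
Proof. by rewrite /= -sumrN; apply: eq_bigr => i _; rewrite !mxE; ring. Qed.

Lemma wform_ge0 b l : (forall i, 0 <= theta i) -> {in l, forall z, orthant z} ->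
  0 <= wform b l.
Proof.
move=> th0; elim: l b => [|z l IH] b lP //=; apply: sumr_ge0 => i _.
apply: mulr_ge0; last by apply: IH => z' z'l; apply: lP; rewrite inE z'l orbT.
by rewrite mulr_ge0 ?exprn_ge0//; apply: lP; rewrite mem_head.
Qed.

(** The hypothesis bounds [F] alone, at every multi-index up to [q]. Symmetry carries [F] to the end
    of the list, past the nonnegative arguments; by then each entry of [b] has grown by at most
    [size l]. *)
Lemma le_wform_head b F l (c : R) (q : nat) :
  (forall i, 0 <= theta i) -> {in l, forall z, orthant z} ->
  (forall b', (forall i, (b' i <= q)%N) ->
     \sum_i weight b' i * F ord0 i <= c) ->
  (forall i, (b i + size l <= q)%N) ->
  wform b (F :: l) <= c * wform b l.
Proof.
move=> th0 + Fc; elim: l b => [|z l IH] b lP bq.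
  rewrite /= mulr1; under eq_bigr do rewrite mulr1.
  by apply: Fc => i; rewrite (leq_trans _ (bq i))// leq_addr.
have lP' : {in l, forall z, orthant z}.
  by move=> z' z'l; apply: lP; rewrite inE z'l orbT.
have z0 : orthant z by apply: lP; rewrite mem_head.
rewrite wform_swap /= big_distrr/=; apply: ler_sum => i _.
rewrite [leRHS]mulrCA; apply: ler_wpM2l.
  by rewrite mulr_ge0 ?exprn_ge0//; exact: z0.
apply: IH => // j; rewrite (leq_trans _ (bq j))//= /bump_at -addnA leq_add2l.
by case: (j == i) => /=.
Qed.

(** By symmetry the nonnegative arguments in [l] can be read first. What remains is the form on
    [[:: z1; z2]] at a shifted multi-index, hence the hypothesis for all [b']. *)
Lemma wform_pair_ge0 b z1 z2 l :
  (forall i, 0 <= theta i) -> {in l, forall z, orthant z} ->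
  (forall b', 0 <= wform b' [:: z1; z2]) -> 0 <= wform b (z1 :: z2 :: l).
Proof.
move=> th0 + z12; elim: l b => [|z l IH] b lP; first exact: z12.
have -> : wform b [:: z1, z2, z & l] = wform b [:: z, z1, z2 & l].
  rewrite [RHS]wform_swap; apply: eq_bigr => i _.
  by rewrite -[in LHS]/(wform _ (z2 :: z :: l)) wform_swap.
rewrite [wform _ _]/=; apply: sumr_ge0 => i _; apply: mulr_ge0.
  by rewrite mulr_ge0 ?exprn_ge0//; apply: lP; rewrite mem_head.
by apply: IH => z' z'l; apply: lP; rewrite inE z'l orbT.
Qed.

(** The copies of [x] are replaced by [y] one at a time, each replacement adding a nonnegative form
    with [z] and [y - x] among its arguments. For $z = D(y-x)$ this is the monotonicity of $D\nabla
    H$ on the orthant. *)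
Lemma le_wform_nseq b z x y k :
  (forall i, 0 <= theta i) -> orthant x -> orthant y ->
  (forall b', 0 <= wform b' [:: z; y - x]) ->
  wform b (z :: nseq k x) <= wform b (z :: nseq k y).
Proof.
move=> th0 x0 y0 zyx; elim: k b => [//|k IH] b.
rewrite -![nseq k.+1 _]/(_ :: nseq k _).
have -> : wform b [:: z, y & nseq k y] =
    wform b [:: z, y - x & nseq k y] + wform b [:: z, x & nseq k y].
  by rewrite !(wform_swap b z) -wformD subrK.
apply: (le_trans _ (lerD (wform_pair_ge0 b th0 _ zyx) (lexx _))); last first.
  by move=> ? /nseqP[->].
rewrite add0r !(wform_swap b z) [leLHS]/= [leRHS]/=; apply: ler_sum => i _.
apply: ler_wpM2l; first by rewrite mulr_ge0 ?exprn_ge0//; exact: x0.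
exact: IH.
Qed.

(** With all weights equal to 1 the form on [k] copies of [z] is the [k]-th power of the sum;
    weights at least 1 can only increase it. *)
Lemma ge_wform_nseq b z k : (forall i, 1 <= theta i) -> orthant z ->
  (\sum_i z ord0 i) ^+ k <= wform b (nseq k z).
Proof.
move=> th1 z0; elim: k b => [//|k IH] b; rewrite exprS /= big_distrl/=.
apply: ler_sum => i _; apply: ler_pM => //.
- by rewrite exprn_ge0// sumr_ge0// => j _; exact: z0.
- by rewrite ler_peMl ?exprn_ege1.
Qed.

(** No entry of the multi-index exceeds [q] along the recursion, so every weight met is at most
    [c]. *)
Lemma wform_nseq_le b z k (q : nat) (c : R) : (forall i, 1 <= theta i) ->
  (forall i, theta i ^+ (2 * q + 1) <= c) -> orthant z ->
  (forall i, (b i + k <= q)%N) ->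
  wform b (nseq k z) <= (c * \sum_i z ord0 i) ^+ k.
Proof.
move=> th1 thc z0; elim: k b => [//|k IH] b bq.
rewrite exprS /=; set X := (_ ^+ k).
rewrite big_distrr big_distrl /=; apply: ler_sum => i _; apply: ler_pM.
- by rewrite mulr_ge0 ?z0// exprn_ge0// (le_trans ler01).
- by apply: wform_ge0 => [j|_ /nseqP[->]//]; exact: le_trans (th1 j).
- apply: ler_wpM2r; first exact: z0.
  apply: le_trans (thc i); rewrite /weight ler_weXn2l// leq_add2r leq_mul2l/=.
  exact: leq_trans (leq_addr _ _) (bq i).
- apply: IH => j; rewrite (leq_trans _ (bq j))// /bump_at -addnA leq_add2l.
  by case: (j == i) => /=.
Qed.

(** By symmetry the [k] terms of the product rule coincide. For [k = 0] the truncated [k.-1] is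
    harmless because of the factor [k%:R]. *)
Lemma is_derive_wform_nseq b k (z : R -> 'rV[R]_m) (t : R) (z' : 'rV[R]_m) :
  (forall i, is_derive t 1 (fun s => z s ord0 i) (z' ord0 i)) ->
  is_derive t 1 (fun s => wform b (nseq k (z s)))
    (k%:R * wform b (z' :: nseq k.-1 (z t))).
Proof.
move=> dz; elim: k b => [|k IH] b.
  by rewrite mul0r; exact: is_derive_cst.
have dX i : is_derive t 1
    (fun s => weight b i * z s ord0 i * wform (bump_at b i) (nseq k (z s)))
    (weight b i * z' ord0 i * wform (bump_at b i) (nseq k (z t)) +
     k%:R * (weight b i * z t ord0 i *
       wform (bump_at b i) (z' :: nseq k.-1 (z t)))).
  have d1 : is_derive t 1 (fun s => weight b i * z s ord0 i)
      (weight b i * z' ord0 i) by exact: is_deriveZ.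
  apply: (is_derive_eq (is_deriveM d1 (IH (bump_at b i)))).
  by rewrite /= /GRing.scale/=; ring.
have -> : (fun s => wform b (nseq k.+1 (z s))) = \sum_i
    (fun s => weight b i * z s ord0 i * wform (bump_at b i) (nseq k (z s))).
  by apply/funext => s; rewrite fct_sumE.
apply: is_derive_eq; rewrite big_split/= -big_distrr/=.
rewrite -[X in _ + _ * X]/(wform b (z t :: z' :: nseq k.-1 (z t))) wform_swap.
(* [z t :: nseq k.-1 (z t)] is [nseq k (z t)] only for [k > 0]; for [k = 0] that term has
   coefficient 0. *)
case: k {IH dX} => [|k]; first by rewrite mul0r addr0 mul1r.
by rewrite -[X in X + _]/(wform b (z' :: nseq k.+1 (z t))) [k.+2%:R]mulrS mulrDl mul1r.
Qed.

End weighted_form.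

(** * Choice of the weights *)

(** Back substitution from the last index: [a j] is [c j] minus the sum of [a k * A k j] over
    [k > j]. That sum is nonnegative and, since [c j] dominates the later [c k], at most [c j]. *)
Lemma unitriangular_comb (R : realFieldType) m (A : 'M[R]_m) (B : R)
    (c : 'rV[R]_m) :
  (forall i j : 'I_m, (i < j)%N -> A i j = 0) -> (forall i, A i i = 1) ->
  (forall i j : 'I_m, (j < i)%N -> 0 <= A i j <= B) ->
  (forall j, 0 <= c ord0 j) ->
  (forall j : 'I_m, B * \sum_(k < m | (j < k)%N) c ord0 k <= c ord0 j) ->
  exists2 a : 'rV[R]_m, forall j, 0 <= a ord0 j <= c ord0 j & c = a *m A.
Proof.
move=> A0 A1 AB c0 cB.
have Au : A \in unitmx.
  rewrite unitmxE det_trig; last first.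
    by apply/is_trig_mxP => i j ij; exact: A0.
  by rewrite big1// unitr1.
exists (c *m invmx A); last by rewrite mulmxKV.
set a := c *m invmx A.
have cE j : c ord0 j = a ord0 j + \sum_(k < m | (j < k)%N) a ord0 k * A k j.
  have -> : c ord0 j = (a *m A) ord0 j by rewrite mulmxKV.
  rewrite mxE (bigD1 j)//= A1 mulr1; congr (_ + _).
  rewrite [LHS](bigID (fun k : 'I_m => (j < k)%N))/= [X in _ + X]big1 ?addr0.
    apply: eq_bigl => k; rewrite -val_eqE /= andbC; case: ltnP => //= jk.
    by rewrite gtn_eqF.
  move=> k /andP[kj]; rewrite -leqNgt => kj'; rewrite A0 ?mulr0//.
  by rewrite ltn_neqAle val_eqE kj.
(* Induction on a bound for [m - j], hence from the last index downwards; with the bound 0 there is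
   no such [j]. *)
suff H N (j : 'I_m) : (m - j <= N)%N -> 0 <= a ord0 j <= c ord0 j by move=> j; exact: H.
elim: N j => [j|N IH j jN].
  by rewrite leqn0 subn_eq0 leqNgt ltn_ord.
have IHk (k : 'I_m) : (j < k)%N -> 0 <= a ord0 k <= c ord0 k.
  move=> jk; apply: IH; rewrite -ltnS (leq_trans _ jN)// ltn_sub2l//.
have S0 : 0 <= \sum_(k < m | (j < k)%N) a ord0 k * A k j.
  apply: sumr_ge0 => k jk; have /andP[? _] := IHk _ jk.
  by have /andP[? _] := AB _ _ jk; exact: mulr_ge0.
have S1 : \sum_(k < m | (j < k)%N) a ord0 k * A k j <= c ord0 j.
  apply: le_trans (cB j); rewrite big_distrr/=; apply: ler_sum => k jk.
  have /andP[? ?] := IHk _ jk; have /andP[? ?] := AB _ _ jk.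
  by rewrite [leRHS]mulrC; exact: ler_pM.
have := cE j; lra.
Qed.

(** Writing [c = a *m A] regroups the left side into nonnegative multiples [a k] of the row sums,
    each at most [S]; then [a k <= c k] and [0 <= S] conclude. *)
Lemma le_sum_unitriangular (R : realFieldType) m (A : 'M[R]_m) (B : R)
    (c : 'rV[R]_m) (F : 'I_m -> R) (S : R) :
  (forall i j : 'I_m, (i < j)%N -> A i j = 0) -> (forall i, A i i = 1) ->
  (forall i j : 'I_m, (j < i)%N -> 0 <= A i j <= B) ->
  (forall j, 0 <= c ord0 j) ->
  (forall j : 'I_m, B * \sum_(k < m | (j < k)%N) c ord0 k <= c ord0 j) ->
  0 <= S -> (forall k : 'I_m, \sum_(j < m | (j <= k)%N) A k j * F j <= S) ->
  \sum_i c ord0 i * F i <= (\sum_i c ord0 i) * S.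
Proof.
move=> A0 A1 AB c0 cB S0 FS.
have [a aP ca] := unitriangular_comb A0 A1 AB c0 cB.
have -> : \sum_i c ord0 i * F i =
    \sum_k a ord0 k * \sum_(j < m | (j <= k)%N) A k j * F j.
  rewrite [in LHS]ca; under eq_bigr do rewrite mxE big_distrl/=.
  rewrite exchange_big/=; apply: eq_bigr => k _; rewrite big_distrr/=.
  rewrite [RHS]big_mkcond/=; apply: eq_bigr => j _.
  by case: leqP => [|kj]; rewrite ?mulrA// A0// mulr0 mul0r.
rewrite big_distrl/=; apply: ler_sum => k _; have /andP[a0 ac] := aP k.
apply: (@le_trans _ _ (a ord0 k * S)); first by rewrite ler_wpM2l.
by rewrite ler_wpM2r.
Qed.

Section weights.
Context {R : realType} {m : nat}.

(** In the variables [X i] the form is the sum of all $d_i X_i X_j$ plus the diagonal excess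
    $d_i(\theta_i^2-1)X_i^2$. By Young's inequality the first sum is at least minus a combination of
    squares, which the excess absorbs. *)
Lemma wform_pair_diag_ge0 (theta d : 'I_m -> R) b (z : 'rV[R]_m) :
  (forall i, 1 <= theta i) -> (forall i, 0 <= d i) ->
  (forall i, m%:R * d i + \sum_j d j <= d i * (theta i - 1) *+ 2) ->
  0 <= wform theta b [:: \row_i (d i * z ord0 i); z].
Proof.
move=> th1 d0 hd; pose X i := weight theta b i * z ord0 i.
have -> : wform theta b [:: \row_i (d i * z ord0 i); z] =
   \sum_i (\sum_j d i * X i * X j + d i * (theta i ^+ 2 - 1) * X i ^+ 2).
  apply: eq_bigr => i _; rewrite mxE /= big_distrr/=.
  rewrite (bigD1 i)// [in RHS](bigD1 i)//= addrAC; congr (_ + _).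
    (* Raising the same index twice yields the square of [weight b i] times [theta i ^+ 2], the
       source of the diagonal excess. *)
    rewrite /X /weight /bump_at eqxx mulnDr muln1 addnAC.
    by rewrite [theta i ^+ (2 * b i + 1 + 2)]exprD; ring.
  apply: eq_bigr => j ji; rewrite /X /weight /bump_at (negbTE ji) addn0; ring.
have hX i j : - (d i * (X i ^+ 2 + X j ^+ 2) / 2) <= d i * X i * X j.
  rewrite -subr_ge0 (_ : _ - _ = d i * ((X i + X j) ^+ 2 / 2)); last by field.
  by rewrite mulr_ge0// divr_ge0// sqr_ge0.
rewrite big_split/=.
have : \sum_i \sum_j - (d i * (X i ^+ 2 + X j ^+ 2) / 2) <=
       \sum_i \sum_j d i * X i * X j.
  by apply: ler_sum => i _; apply: ler_sum => j _.
have -> : \sum_i \sum_j - (d i * (X i ^+ 2 + X j ^+ 2) / 2) =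
    - \sum_i (m%:R * d i + \sum_j d j) / 2 * X i ^+ 2.
  rewrite -sumrN.
  under eq_bigr => i _ do under eq_bigr => j _ do
    rewrite mulrDr mulrDl opprD.
  under eq_bigr do rewrite big_split/=.
  rewrite big_split/= [X in _ + X]exchange_big/= -big_split/=.
  apply: eq_bigr => i _; rewrite sumr_const card_ord -mulr_natl sumrN.
  by rewrite -mulr_suml -mulr_suml; field.
suff : \sum_i (m%:R * d i + \sum_j d j) / 2 * X i ^+ 2 <=
    \sum_i d i * (theta i ^+ 2 - 1) * X i ^+ 2 by lra.
apply: ler_sum => i _; apply: ler_wpM2r; first exact: sqr_ge0.
apply: (@le_trans _ _ (d i * (theta i - 1))).
  by rewrite ler_pdivrMr// mulr_natr hd.
apply: ler_wpM2l => //; rewrite lerD2r -[leLHS]mulr1 expr2.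
by rewrite ler_wpM2l// (le_trans ler01).
Qed.

(** The weights are $\theta_j=\tau^{(q+1)^{m-j}}$. For $k>j$ and $e_k\le q$ the power of $\tau$ in
    $\theta_k^{e_k}$ is strictly smaller than that in $\theta_j$, so one factor $\tau$ is left over
    to pay for $Bm$. *)
Lemma tower_weights (tau B : R) (q : nat) : 1 <= tau -> 0 <= B ->
  B * m%:R <= tau ->
  exists theta : 'I_m -> R,
  [/\ forall i, tau <= theta i &
      forall (e : 'I_m -> nat) (j : 'I_m), (forall i, 0 < e i <= q)%N ->
        B * \sum_(k < m | (j < k)%N) theta k ^+ e k <= theta j ^+ e j].
Proof.
move=> tau1 B0 Bm; pose N (j : nat) := (q.+1 ^ (m - j))%N.
have N0 j : (0 < N j)%N by rewrite expn_gt0.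
exists (fun j => tau ^+ N j); split=> [i|e j eq].
  by rewrite -[leLHS]expr1 ler_weXn2l.
have tau0 : 0 <= tau by rewrite (le_trans ler01).
apply: (@le_trans _ _ (B * \sum_(k < m) tau ^+ (N j).-1)).
  apply: ler_wpM2l => //; rewrite [leLHS]big_mkcond/=; apply: ler_sum => k _.
  case: ifPn => jk; last exact: exprn_ge0.
  rewrite -exprM ler_weXn2l// -ltnS prednK//.
  have /andP[_ ek] := eq k.
  apply: (@leq_ltn_trans (N k * q)); first by rewrite leq_mul2l ek orbT.
  apply: (@leq_trans (N k * q.+1)); first by rewrite ltn_mul2l N0 /=.
  by rewrite -expnSr leq_pexp2l// ltn_sub2l.
rewrite sumr_const card_ord -[_ *+ m]mulr_natl mulrA.
apply: (@le_trans _ _ (tau ^+ N j)).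
  by rewrite -[in leRHS](prednK (N0 j)) exprS ler_wpM2r// exprn_ge0.
have /andP[ej _] := eq j.
by rewrite -exprM ler_weXn2l// leq_pmulr.
Qed.

(** A single choice of weights serves both estimates: large enough for the diffusion form to be
    nonnegative, and falling off fast enough along the index for (INT-SUM) to control the
    reaction. *)
Lemma exists_weights (d : 'I_m -> R) (f : 'rV[R]_m -> 'rV[R]_m) (A : 'M[R]_m)
    (L : R) (p : nat) :
  (forall i, 0 < d i) -> intermediate_sums f A L ->
  exists (theta : 'I_m -> R) (C : R),
  [/\ 0 <= C, forall i, 1 <= theta i,
      forall i, theta i ^+ (2 * p + 1) <= C,
      forall b u, (forall i, (b i <= p)%N) -> orthant u ->
        \sum_i weight theta b i * f u ord0 i <= C * (\sum_i u ord0 i + 1) &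
      forall b (z : 'rV[R]_m), 0 <= wform theta b [:: \row_i (d i * z ord0 i); z]].
Proof.
move=> d0 [A0 A1 Apos L0 fL].
pose B : R := \sum_i \sum_j `|A i j|.
have AB i j : A i j <= B.
  apply: le_trans (ler_norm _) _; rewrite /B (bigD1 i)//= (bigD1 j)//= -addrA.
  by rewrite lerDl addr_ge0// sumr_ge0// => *; rewrite ?sumr_ge0.
have B0 : 0 <= B by do 2 (apply: sumr_ge0 => * ).
(* Each summand is twice the lower bound that [wform_pair_diag_ge0] requires for [theta i - 1]; the
   sum dominates them all. *)
pose T : R := \sum_i (m%:R + (\sum_j d j) / d i).
have T0 i : 0 <= m%:R + (\sum_j d j) / d i.
  by rewrite addr_ge0// divr_ge0 ?(ltW (d0 i))// sumr_ge0// => j _; exact: ltW.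
pose tau := 1 + T + B * m%:R.
have Tge0 : 0 <= T by apply: sumr_ge0.
have Bm0 : 0 <= B * m%:R by rewrite mulr_ge0.
(* The exponents in [weight] are [2 * b i + 1] with [b i <= p], hence the bound [2 * p + 1]. *)
have [| |theta [thtau thB]] := @tower_weights tau B (2 * p + 1) _ B0.
- by rewrite /tau; lra.
- by rewrite /tau; lra.
have th1 i : 1 <= theta i by apply: le_trans (thtau i); rewrite /tau; lra.
pose Q := \sum_i theta i ^+ (2 * p + 1).
have Q0 i : 0 <= theta i ^+ (2 * p + 1).
  by rewrite exprn_ge0// (le_trans ler01).
(* [Q] bounds the powers of the weights, [Q * L] the reaction term. *)
exists theta, (Q + Q * L); split => //.
- by rewrite addr_ge0 ?mulr_ge0 ?(ltW L0)// sumr_ge0.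
- move=> i; apply: (@le_trans _ _ Q).
    by rewrite /Q (bigD1 i)//= lerDl sumr_ge0.
  by rewrite lerDl mulr_ge0 ?(ltW L0)// sumr_ge0.
- move=> b u bp u0.
  have S0 : 0 <= \sum_i u ord0 i + 1 by rewrite addr_ge0// sumr_ge0// => i _.
  pose c : 'rV[R]_m := \row_i weight theta b i.
  have cE i : c ord0 i = weight theta b i by rewrite mxE.
  have w0 i : 0 <= weight theta b i by rewrite exprn_ge0// (le_trans ler01).
  rewrite (eq_bigr (fun i => c ord0 i * f u ord0 i)); last first.
    by move=> i _; rewrite cE.
  apply: (le_trans (@le_sum_unitriangular R m A B c (fun j => f u ord0 j)
    (L * (\sum_i u ord0 i + 1)) A0 A1 _ _ _ _ _)).
  + by move=> i j ij; rewrite AB (ltW (Apos _ _ ij)).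
  + by move=> j; rewrite cE.
  + move=> j; rewrite cE; under eq_bigr do rewrite cE.
    apply: thB => i; rewrite leq_add2r leq_mul2l/= bp andbT.
    by rewrite addn1.
  + by rewrite mulr_ge0// ltW.
  + by move=> k; exact: fL.
  rewrite mulrA; apply: ler_wpM2r => //.
  apply: (@le_trans _ _ (Q * L)); last by rewrite lerDr sumr_ge0.
  apply: ler_wpM2r; first exact: ltW.
  apply: ler_sum => i _; rewrite cE ler_weXn2l// leq_add2r leq_mul2l/=.
  exact: bp.
- move=> b z; apply: wform_pair_diag_ge0 => // i; first exact: ltW.
  have : (m%:R + (\sum_j d j) / d i) <= theta i - 1.
    apply: (@le_trans _ _ T); first by rewrite /T [leRHS](bigD1 i)//= lerDl sumr_ge0.
    by have := thtau i; rewrite /tau; lra.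
  move=> /(ler_wpM2l (ltW (d0 i))) h.
  have di := d0 i.
  have <- : d i * (m%:R + (\sum_j d j) / d i) = m%:R * d i + \sum_j d j.
    by field; rewrite gt_eqF.
  rewrite mulr2n (le_trans h)// lerDl mulr_ge0 ?(ltW di)// subr_ge0.
  exact: th1.
Qed.

End weights.

(** * Integration and continuity *)

Lemma le_bounded_integrable d (T : measurableType d) (R : realType)
    (mu : {measure set T -> \bar R}) (D : set T) (f : T -> R) (M : R) :
  measurable D -> (mu D < +oo)%E -> measurable_fun D f ->
  (forall x, D x -> `|f x| <= M) -> mu.-integrable D (EFin \o f).
Proof.
move=> mD muD mf fM; apply: measurable_bounded_integrable => //.
exists M; split=> [|N MN x Dx]; first exact: num_real.
by apply: le_trans (ltW MN); exact: fM.
Qed.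

(** * Fubini's theorem and double integrals of antisymmetrized kernels *)

Section antisymmetrization.
Context d (T : measurableType d) (R : realType).
Variables (mu : {sigma_finite_measure set T -> \bar R}) (D : set T).
Hypotheses (mD : measurable D) (muD : (mu D < +oo)%E).

Section swap.
Variables (K : T * T -> R) (M : R).
Hypothesis mK : measurable_fun (D `*` D) K.
Hypothesis KM : forall x y, D x -> D y -> `|K (x, y)| <= M.

(** Extension by zero makes the kernel a function on the whole product space, where Fubini's theorem
    is applied. *)
Let f : T * T -> \bar R := (EFin \o K) \_ (D `*` D).

Let integrable_f : (mu \x mu)%E.-integrable setT f.
Proof.
have mDD : measurable (D `*` D) by exact: measurableX.
apply/integrable_restrict => //; rewrite setTI.
apply: (@le_bounded_integrable _ _ _ _ _ _ M) => //.
  have muDfin : mu D \is a fin_num by rewrite ge0_fin_numE.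
  apply: (@le_lt_trans _ _ (mu D * mu D)%E); last by rewrite lte_mul_pinfty.
  by rewrite -(product_measure1E mu mu mD mD).
by move=> -[x y] [/= Dx Dy]; exact: KM.
Qed.

Let mf : measurable_fun [set: T * T] f. Proof. exact: measurable_int integrable_f. Qed.

Lemma integrable_xsection x : D x ->
  mu.-integrable D (EFin \o (fun y => K (x, y))).
Proof.
move=> Dx; apply: (@le_bounded_integrable _ _ _ _ _ _ M) => //; last first.
  by move=> y Dy; exact: KM.
apply/measurable_EFinP.
have := measurable_funS measurableT (@subsetT _ D) (measurableT_comp mf (pair1_measurable x)).
apply: eq_measurable_fun => y /set_mem Dy /=; rewrite /f patchE mem_set//.
Qed.

Let integrable_fy y : D y ->
  mu.-integrable D (EFin \o (fun x => K (x, y))).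
Proof.
move=> Dy; apply: (@le_bounded_integrable _ _ _ _ _ _ M) => //; last first.
  by move=> x Dx; exact: KM.
apply/measurable_EFinP.
have := measurable_funS measurableT (@subsetT _ D) (measurableT_comp mf (pair2_measurable y)).
apply: eq_measurable_fun => x /set_mem Dx /=; rewrite /f patchE mem_set//.
Qed.

Let fE x : D x ->
  (\int[mu]_y f (x, y) = (\int[mu]_(y in D) K (x, y))%:E)%E.
Proof.
move=> Dx; rewrite /Rintegral fineK; last first.
  exact/integrable_fin_num/integrable_xsection.
rewrite [in RHS]integral_mkcond; apply: eq_integral => y _.
rewrite /f !patchE.
by congr (if _ then _ else _); apply/idP/idP; rewrite !inE => // -[].
Qed.

Let fE' y : D y ->
  (\int[mu]_x f (x, y) = (\int[mu]_(x in D) K (x, y))%:E)%E.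
Proof.
move=> Dy; rewrite /Rintegral fineK; last first.
  exact/integrable_fin_num/integrable_fy.
rewrite [in RHS]integral_mkcond; apply: eq_integral => x _.
rewrite /f !patchE.
by congr (if _ then _ else _); apply/idP/idP; rewrite !inE => // -[].
Qed.

Lemma Rintegral_swap : \int[mu]_(x in D) \int[mu]_(y in D) K (x, y) =
  \int[mu]_(y in D) \int[mu]_(x in D) K (x, y).
Proof.
have FB := Fubini integrable_f; rewrite [in LHS]/Rintegral [in RHS]/Rintegral.
congr fine; rewrite integral_mkcond [RHS]integral_mkcond.
(* For [x] outside [D] the section of [f] vanishes, in agreement with the zero extension of the
   outer integrand. *)
rewrite -[LHS](_ : (\int[mu]_x \int[mu]_y f (x, y) = _)%E); last first.
  apply: eq_integral => x _; rewrite patchE; case: ifPn => [/set_mem/fE//|nDx].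
  apply: integral0_eq => y _; rewrite /f patchE memNset// => -[/mem_set].
  by rewrite (negbTE nDx).
rewrite FB; apply: eq_integral => y _.
rewrite patchE; case: ifPn => [/set_mem/fE'//|nDy].
apply: integral0_eq => x _; rewrite /f patchE memNset// => -[_ /mem_set].
by rewrite (negbTE nDy).
Qed.

Lemma integrable_Rintegral : mu.-integrable D
  (EFin \o (fun x => \int[mu]_(y in D) K (x, y))).
Proof.
have iF := integrable_fubini_F integrable_f.
have := @integrableS _ _ _ mu setT D _ measurableT mD (@subsetT _ D) iF.
by apply: eq_integrable => // x /set_mem Dx /=; rewrite /fubini_F fE.
Qed.

End swap.

(** By Fubini's theorem the transposed kernel has the same double integral, so twice the integral is
    that of [K (x, y) + K (y, x)]. *)
Lemma Rintegral_antisym_le0 (K : T * T -> R) (M : R) :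
  measurable_fun (D `*` D) K ->
  (forall x y, D x -> D y -> `|K (x, y)| <= M) ->
  (forall x y, D x -> D y -> K (x, y) + K (y, x) <= 0) ->
  \int[mu]_(x in D) \int[mu]_(y in D) K (x, y) <= 0.
Proof.
move=> mK KM Kanti; pose K' (z : T * T) := K (z.2, z.1).
have mK' : measurable_fun (D `*` D) K'.
  apply: (@measurable_comp _ _ _ _ _ _ (D `*` D) K _ (fun z => (z.2, z.1))) => //.
  - exact: measurableX.
  - by move=> _ [[x y] [/= Dx Dy] <-].
  - by apply/measurable_funTS/measurable_fun_pair.
have K'M x y : D x -> D y -> `|K' (x, y)| <= M by move=> Dx Dy; exact: KM.
suff : \int[mu]_(x in D) \int[mu]_(y in D) K (x, y) +
       \int[mu]_(x in D) \int[mu]_(y in D) K' (x, y) <= 0.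
  by rewrite (Rintegral_swap mK' K'M) -mulr2n pmulrn_lle0.
rewrite -RintegralD//; [|exact: integrable_Rintegral mK KM|
  exact: integrable_Rintegral mK' K'M].
have -> : 0 = \int[mu]_(x in D) (0 : R) by rewrite Rintegral_cst// mul0r.
apply: le_Rintegral => //.
- exact: (integrableD mD (integrable_Rintegral mK KM)
    (integrable_Rintegral mK' K'M)).
- exact: integrable0.
- move=> x Dx; rewrite -RintegralD//; [|exact: integrable_xsection mK KM _ Dx|
    exact: integrable_xsection mK' K'M _ Dx].
  have -> : 0 = \int[mu]_(y in D) (0 : R) by rewrite Rintegral_cst// mul0r.
  apply: le_Rintegral => //.
  + exact: (integrableD mD (integrable_xsection mK KM Dx)
      (integrable_xsection mK' K'M Dx)).
  + exact: integrable0.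
  + by move=> y Dy; exact: Kanti.
Qed.

End antisymmetrization.

(** * Continuity within a set, Borel measurability and boundedness *)

Lemma continuous_within_comp (T U V : topologicalType) (A : set T) (B : set U)
    (f : T -> U) (g : U -> V) :
  {within A, continuous f} -> (forall x, A x -> B (f x)) ->
  {within B, continuous g} -> {within A, continuous (g \o f)}.
Proof.
move=> /subspace_continuousP cf fAB /subspace_continuousP cg.
apply/subspace_continuousP => x Ax.
apply: (@cvg_comp _ _ _ f g _ (within B (nbhs (f x)))); last exact: (cg _ (fAB _ Ax)).
move=> P BP; have := cf x Ax _ BP; rewrite /nbhs/= /within/=.
by apply: filterS => y fy Ay; apply: fy => //; exact: fAB.
Qed.

(** Measurability refers to the product of the two Borel sigma-algebras. It contains the open sets
    because each is a countable union of boxes with rational centres and radii $1/(k+1)$. *)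
Lemma open_rV_prod_measurable (R : realType) n m (W : set ('rV[R]_n * 'rV[R]_m)) :
  open W -> measurable W.
Proof.
move=> oW.
pose B (t : 'rV[rat]_n * 'rV[rat]_m * nat) : set ('rV[R]_n * 'rV[R]_m) :=
  ball (map_mx ratr t.1.1 : 'rV[R]_n) t.2.+1%:R^-1 `*`
  ball (map_mx ratr t.1.2 : 'rV[R]_m) t.2.+1%:R^-1.
pose F t := if `[< B t `<=` W >] then B t else set0.
have -> : W = \bigcup_t F t.
  apply/seteqP; split=> [[x y] Wxy|z [t _]]; last first.
    by rewrite /F; case: asboolP => [BW /BW|].
  have /nbhs_ballP[e /= e0 eW] := open_nbhs_nbhs (conj oW Wxy).
  (* With twice the radius below [e], a box whose centre is within that radius of the point lies
     inside the [e]-ball around the point. *)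
  have [k _ ke] : exists2 k, True & 2 * k.+1%:R^-1 < e.
    exists (Num.truncn (2 / e)) => //.
    rewrite ltr_pdivrMr// mulrC -ltr_pdivrMr//.
    exact: truncnS_gt.
  pose r : R := k.+1%:R^-1.
  have r0 : 0 < r by rewrite invr_gt0.
  have approx (a : R) : exists q : rat, ball (ratr q : R) r a.
    have [|q] := @rat_in_itvoo R (a - r) (a + r).
      by rewrite ltrBlDr -addrA ltrDl addr_gt0.
    rewrite in_itv/= => /andP[aq qa]; exists q.
    by rewrite /ball/= ltr_norml; apply/andP; split; lra.
  have [q qP] := choice approx.
  have close (c x1 x2 : R) : ball c r x1 -> ball c r x2 -> ball x1 e x2.
    rewrite /ball/= => c1 c2; apply: lt_trans ke.
    have -> : x1 - x2 = (c - x2) - (c - x1) by ring.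
    by apply: le_lt_trans (ler_normB _ _) _; rewrite mulr_natl mulr2n ltrD.
  exists ((\row_j q (x ord0 j), \row_j q (y ord0 j)), k) => //; rewrite /F.
  case: asboolP => [_|[]].
    by split => /=; split => [//|i j]; rewrite !mxE (ord1 i).
  move=> [x' y'] [/= [_ bx] [_ by_]]; apply: eW; split => /=.
    by split => // i j; have := bx i j; rewrite !mxE (ord1 i); exact: close.
  by split => // i j; have := by_ i j; rewrite !mxE (ord1 i); exact: close.
apply: countable_bigcupT_measurable => [|t]; first exact: countableP.
rewrite /F; case: asboolP => _ //.
by apply: measurableX; apply: open_rV_measurable; exact: ball_open.
Qed.

Lemma within_continuous_rV_measurable (R : realType) n (D : set 'rV[R]_n)
    (f : 'rV[R]_n -> R) :
  measurable D -> {within D, continuous f} -> measurable_fun D f.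
Proof.
move=> mD /continuousP cf.
apply: (measurability _ (RGenOpens.measurableE R)).
move=> _ [_ [a [b ->] <-]].
have /open_subspaceP[V oV VD] : open (f @^-1` `]a, b[ : set (subspace D)).
  exact/cf/interval_open.
by rewrite setIC -VD; apply: measurableI => //; exact: open_rV_measurable.
Qed.

Lemma within_continuous_rV_prod_measurable (R : realType) n m
    (D : set ('rV[R]_n * 'rV[R]_m)) (f : 'rV[R]_n * 'rV[R]_m -> R) :
  measurable D -> {within D, continuous f} -> measurable_fun D f.
Proof.
move=> mD /continuousP cf.
apply: (measurability _ (RGenOpens.measurableE R)).
move=> _ [_ [a [b ->] <-]].
have /open_subspaceP[V oV VD] : open (f @^-1` `]a, b[ : set (subspace D)).
  exact/cf/interval_open.
by rewrite setIC -VD; apply: measurableI => //; exact: open_rV_prod_measurable.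
Qed.

Lemma bounded_rV_measure_lty (R : realType) n (D : set 'rV[R]_n) :
  measurable D -> bounded_set D -> (lebesgue_rV D < +oo)%E.
Proof.
move=> mD [M [_ DM]].
(* [bounded_set] bounds the norms only by numbers strictly greater than [M], and the sign of [M] is
   unknown; hence $|M|+1$. *)
pose A (i : 'I_n) : set (measurableTypeR R) :=
  `[(- (`|M| + 1)), `|M| + 1]%classic.
have mA i : measurable (A i) by exact: measurable_itv.
have mbox : measurable [set x : 'rV[R]_n | forall i, A i (x ord0 i)].
  have -> : [set x : 'rV[R]_n | forall i, A i (x ord0 i)] =
          \bigcap_(i in [set: 'I_n]) ((fun x : 'rV[R]_n => x ord0 i) @^-1` A i).
    by apply/seteqP; split=> [x xA i _|x xA i]; exact: xA.
  apply: fin_bigcap_measurable => // i _; rewrite -[X in measurable X]setTI.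
  exact: measurable_coord_rV.
apply: (@le_lt_trans _ _
  (lebesgue_rV [set x : 'rV[R]_n | forall i, A i (x ord0 i)])).
  apply: le_measure; rewrite ?inE// => x Dx i; rewrite /A/= in_itv/= -ler_norml.
  apply: (@le_trans _ _ `|x|).
    rewrite [leRHS]/Num.norm/= mx_normrE.
    by apply/bigmax_geP; right => /=; exists (ord0, i).
  by apply: DM => //; rewrite ltr_pwDr// ler_norm.
rewrite lebesgue_rV_box// -ge0_fin_numE; last first.
  by apply: prode_ge0 => i _; exact: measure_ge0.
apply: prode_fin_num => i _; rewrite lebesgue_measure_itv/=.
by case: ifPn => // _; rewrite -EFinB.
Qed.

Lemma bounded_closure (R : realType) (V : normedModType R) (D : set V) :
  bounded_set D -> bounded_set (closure D).
Proof.
move=> [M [Mr DM]]; exists M; split=> // N MN.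
have : closed [set x : V | `|x| <= N].
  apply: (@closed_comp _ _ (fun x : V => `|x|) [set y : R | y <= N]).
    by move=> x _; exact: norm_continuous.
  exact: closed_le.
move=> /closure_id cN x; rewrite /= => Dx; suff : [set x : V | `|x| <= N] x by [].
rewrite cN; apply: closureS Dx => y Dy; exact: DM.
Qed.

Lemma compact_continuous_bounded (R : realType) (T : topologicalType)
    (A : set T) (f : T -> R) :
  compact A -> {within A, continuous f} ->
  exists M, forall x, A x -> `|f x| <= M.
Proof.
move=> cA cf; have [M [_ fM]] := compact_bounded (continuous_compact cf cA).
exists (`|M| + 1) => x Ax; apply: fM; last by exists x.
by rewrite ltr_pwDr// ler_norm.
Qed.

Section continuous_wform.
Context {R : realType} {m : nat} {T : topologicalType}.

(** [T] is arbitrary, so that a [subspace] may be taken for it, which covers continuity within a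
    set. *)
Lemma continuous_wform_cons (theta : 'I_m -> R) b (y : T -> 'rV[R]_m)
    (l : T -> seq 'rV[R]_m) :
  (forall i, continuous (fun x => y x ord0 i)) ->
  (forall b', continuous (fun x => wform theta b' (l x))) ->
  continuous (fun x => wform theta b (y x :: l x)).
Proof.
move=> cy cl x /=; apply: cvg_big => [|i _]; first exact: add_continuous.
apply: cvgM; last exact: cl.
by apply: cvgMr; exact: cy.
Qed.

Lemma continuous_wform_nseq (theta : 'I_m -> R) b (z : T -> 'rV[R]_m) k :
  (forall i, continuous (fun x => z x ord0 i)) ->
  continuous (fun x => wform theta b (nseq k (z x))).
Proof.
move=> cz; elim: k b => [|k IH] b; first exact: cst_continuous.
exact: continuous_wform_cons.
Qed.

End continuous_wform.

Lemma Rintegral_sum d (T : measurableType d) (R : realType)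
    (mu : {measure set T -> \bar R}) (D : set T) (I : Type) (r : seq I)
    (F : I -> T -> R) :
  measurable D -> (forall i, mu.-integrable D (EFin \o F i)) ->
  \int[mu]_(x in D) (\sum_(i <- r) F i x) =
  \sum_(i <- r) \int[mu]_(x in D) F i x.
Proof.
move=> mD iF; elim: r => [|i r IH].
  by under eq_Rintegral do rewrite big_nil; rewrite big_nil Rintegral_cst// mul0r.
under eq_Rintegral do rewrite big_cons.
rewrite big_cons RintegralD// ?IH//.
have := @integrable_sum _ _ _ mu D mD I r xpredT (fun i => EFin \o F i)
  (fun i _ => iF i).
by apply: eq_integrable => // x _; rewrite sumEFin.
Qed.

(** * Nonlocal diffusion *)

Section bounded_open.
Context {R : realType} {n : nat}.
Variable Omega : set 'rV[R]_n.
Hypotheses (oO : open Omega) (bO : bounded_set Omega).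

Let mO : measurable Omega. Proof. exact: open_rV_measurable. Qed.

Let muO : (lebesgue_rV Omega < +oo)%E. Proof. exact: bounded_rV_measure_lty. Qed.

Let cptO : compact (closure Omega).
Proof.
by apply: bounded_closed_compact; [exact: bounded_closure|exact: closed_closure].
Qed.

(** The closure is compact, so [g] is bounded, and [Omega] has finite measure. *)
Lemma closure_continuous_integrable (g : 'rV[R]_n -> R) :
  {within closure Omega, continuous g} ->
  (@lebesgue_rV R n).-integrable Omega (EFin \o g).
Proof.
move=> cg; have [M gM] := compact_continuous_bounded cptO cg.
apply: (@le_bounded_integrable _ _ _ _ _ _ M) => //.
  apply: within_continuous_rV_measurable => //.
  exact: continuous_subspaceW (@subset_closure _ _) cg.
by move=> x Ox; apply: gM; exact: subset_closure.
Qed.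

Section diffusion.
Context {m : nat}.
Variables (theta d : 'I_m -> R) (phi : 'rV[R]_n -> 'rV[R]_n -> R).
Variables (U : 'rV[R]_n -> 'rV[R]_m) (b : 'I_m -> nat) (k : nat).
Hypothesis theta_ge0 : forall i, 0 <= theta i.
Hypothesis pair_ge0 : forall b' (z : 'rV[R]_m),
  0 <= wform theta b' [:: \row_i (d i * z ord0 i); z].
Hypothesis cphi : {within closure Omega `*` closure Omega,
  continuous (fun z : 'rV[R]_n * 'rV[R]_n => phi z.1 z.2)}.
Hypothesis phi_ge0 : forall x y, closure Omega x -> closure Omega y ->
  0 <= phi x y.
Hypothesis phiC : forall x y, Omega x -> Omega y -> phi x y = phi y x.
Hypothesis cU : forall i, {within closure Omega, continuous (fun x => U x ord0 i)}.
Hypothesis U_ge0 : forall x, closure Omega x -> orthant (U x).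

Definition nonlocal_diffusion (x : 'rV[R]_n) : 'rV[R]_m :=
  \row_i \int[@lebesgue_rV R n]_(y in Omega)
    (d i * phi x y * (U y ord0 i - U x ord0 i)).

Let cO2 := closure Omega `*` closure Omega.

(** As the form is linear in its first argument, integrating this kernel in [z.2] puts the diffusion
    vector at [z.1] into that argument. *)
Let K (z : 'rV[R]_n * 'rV[R]_n) : R := phi z.1 z.2 *
  wform theta b ((\row_i (d i * (U z.2 - U z.1) ord0 i)) :: nseq k (U z.1)).

Let cU1 i : {within cO2, continuous (fun z : 'rV[R]_n * 'rV[R]_n => U z.1 ord0 i)}.
Proof.
apply: (@continuous_within_comp _ _ _ cO2 (closure Omega) fst
  (fun x => U x ord0 i)); last exact: cU.
  by apply: continuous_subspaceT => z; exact: cvg_fst.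
by move=> z [].
Qed.

Let cU2 i : {within cO2, continuous (fun z : 'rV[R]_n * 'rV[R]_n => U z.2 ord0 i)}.
Proof.
apply: (@continuous_within_comp _ _ _ cO2 (closure Omega) snd
  (fun x => U x ord0 i)); last exact: cU.
  by apply: continuous_subspaceT => z; exact: cvg_snd.
by move=> z [].
Qed.

Let cK : {within cO2, continuous K}.
Proof.
move=> z; apply: cvgM; first exact: cphi.
apply: (@continuous_wform_cons R m (subspace cO2) theta b
  (fun z => \row_i (d i * (U z.2 - U z.1) ord0 i)) (fun z => nseq k (U z.1))).
  move=> i; rewrite (_ : (fun _ => _) =
    (fun z => d i * (U z.2 ord0 i - U z.1 ord0 i))); last first.
    by apply/funext => z'; rewrite !mxE.
  by move=> z'; apply: cvgMr; apply: cvgB; [exact: cU2|exact: cU1].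
by move=> b'; exact: (@continuous_wform_nseq R m (subspace cO2)).
Qed.

Let int_phiU x i : closure Omega x -> (@lebesgue_rV R n).-integrable Omega
  (EFin \o (fun y => d i * phi x y * (U y ord0 i - U x ord0 i))).
Proof.
move=> Ox; apply: closure_continuous_integrable => y.
apply: cvgM; last by apply: cvgB; [exact: cU|exact: cvg_cst].
apply: cvgMr.
suff : {within closure Omega, continuous (phi x)} by apply.
apply: (@continuous_within_comp _ _ _ (closure Omega) cO2 (pair x)
  (fun z => phi z.1 z.2)) => //.
  apply: continuous_subspaceT => z P [[A B] [/= Ax Bz] AB].
  by apply: filterS Bz => y0 By; apply: AB; split=> /=; [exact: nbhs_singleton|].
Qed.

Let KE x : Omega x -> wform theta b (nonlocal_diffusion x :: nseq k (U x)) =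
  \int[@lebesgue_rV R n]_(y in Omega) K (x, y).
Proof.
move=> /subset_closure Ox.
(* The coefficient of the [i]-th component of the first argument; it does not depend on [y]. *)
pose c i := weight theta b i * wform theta (bump_at b i) (nseq k (U x)).
transitivity (\sum_i \int[@lebesgue_rV R n]_(y in Omega)
    (c i * (d i * phi x y * (U y ord0 i - U x ord0 i)))).
  apply: eq_bigr => i _; rewrite RintegralZl//; last exact: int_phiU.
  by rewrite mxE mulrAC.
rewrite -Rintegral_sum//; last first.
  move=> i; have := integrableZl mO (c i) (int_phiU i Ox).
  exact: eq_integrable.
apply: eq_Rintegral => y _; rewrite /K /= big_distrr/=.
by apply: eq_bigr => i _; rewrite !mxE /c; ring.
Qed.

Let K_bounded : exists M, forall x y, Omega x -> Omega y -> `|K (x, y)| <= M.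
Proof.
have [M KM] := compact_continuous_bounded (compact_setX cptO cptO) cK.
by exists M => x y Ox Oy; apply: KM; split; exact: subset_closure.
Qed.

Let mK : measurable_fun (Omega `*` Omega) K.
Proof.
apply: within_continuous_rV_prod_measurable; first exact: measurableX.
by apply: continuous_subspaceW cK => z []; split; exact: subset_closure.
Qed.

Lemma integrable_wform_diffusion : (@lebesgue_rV R n).-integrable Omega
  (EFin \o (fun x => wform theta b (nonlocal_diffusion x :: nseq k (U x)))).
Proof.
have [M KM] := K_bounded.
have := integrable_Rintegral mO muO mK KM; apply: eq_integrable => //.
by move=> x /set_mem Ox /=; rewrite -KE.
Qed.

(** The symmetrized kernel [K (x, y) + K (y, x)] is nonpositive: this is the monotonicity of
    [le_wform_nseq], multiplied by $\varphi\ge0$. *)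
Lemma Rintegral_wform_diffusion_le0 :
  \int[@lebesgue_rV R n]_(x in Omega)
    wform theta b (nonlocal_diffusion x :: nseq k (U x)) <= 0.
Proof.
have [M KM] := K_bounded.
rewrite (_ : Rintegral _ _ _ = \int[@lebesgue_rV R n]_(x in Omega)
  \int[@lebesgue_rV R n]_(y in Omega) K (x, y)); last first.
  by apply: eq_Rintegral => x /set_mem /KE.
apply: (@Rintegral_antisym_le0 _ _ _ (@lebesgue_rV R n) Omega mO muO K M) => //.
move=> x y Ox Oy; have [cx cy] := (subset_closure Ox, subset_closure Oy).
(* [h] is $D(U(y)-U(x))$. Exchanging [x] and [y] changes its sign, while [phiC] makes [phi x y] a
   common factor. *)
pose h : 'rV[R]_m := \row_i (d i * (U y - U x) ord0 i).
have -> : K (x, y) + K (y, x) = phi x y *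
    (wform theta b (h :: nseq k (U x)) + wform theta b (- h :: nseq k (U y))).
  rewrite mulrDr /K [phi (y, x).1 _](phiC Oy Ox); congr (_ + _ * wform _ _ (_ :: _)).
  by apply/rowP => i; rewrite !mxE; ring.
rewrite wformN mulr_ge0_le0 ?phi_ge0// subr_le0.
by apply: le_wform_nseq => //; [exact: U_ge0..|move=> b'; exact: pair_ge0].
Qed.

End diffusion.
End bounded_open.

(** * Gronwall's inequality for integrals *)

(** The half-line is a neighbourhood of [t > 0]: increments with [|h| < t] stay inside it. *)
Lemma is_derive_ge0_is_derive (R : realType) (g : R -> R) (t l : R) :
  0 < t -> is_derive_ge0 g t l -> is_derive t 1 g l.
Proof.
move=> t0 gl.
have H : h^-1 *: ((g \o shift t) (h *: 1) - g t) @[h --> 0^'] --> l.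
  apply: cvg_trans gl => P /= [e /= e0 eP].
  suff : \forall h \near 0^', P (h^-1 *: ((g \o shift t) (h *: 1) - g t)) by [].
  near=> h.
  have -> : h^-1 *: ((g \o shift t) (h *: 1) - g t) =
      (g (h + t) - g t) / (h + t - t).
    by rewrite addrK /GRing.scale/= mulr1 mulrC.
  apply: eP => /=.
  - by rewrite opprD addrC subrK normrN; near: h; exact: dnbhs0_lt.
  - rewrite -subr_eq0 addrK; near: h; exact: nbhs_dnbhs_neq.
  - rewrite in_itv/= andbT -lerBlDr sub0r lerNl.
    have : `|h| < t by near: h; exact: dnbhs0_lt.
    by move=> /ltW; rewrite ler_norml lerNl => /andP[].
by split; [apply/cvg_ex; exists l|exact: cvg_lim].
Unshelve. all: by end_near. Qed.

Section gronwall.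
Context {R : realType} {n : nat}.
Variable Omega : set 'rV[R]_n.
Hypotheses (oO : open Omega) (bO : bounded_set Omega).
Variables (h g : 'rV[R]_n -> R -> R) (a C : R).
Hypothesis ch : {within closure Omega `*` `[0, +oo[,
  continuous (fun z : 'rV[R]_n * R => h z.1 z.2)}.
Hypothesis cg : {within closure Omega `*` `[0, +oo[,
  continuous (fun z : 'rV[R]_n * R => g z.1 z.2)}.
Hypothesis dh : forall x (t : R), Omega x -> 0 < t -> is_derive t 1 (h x) (g x t).
Hypothesis gC : forall t : R, 0 < t ->
  \int[@lebesgue_rV R n]_(x in Omega) g x t <=
  C * (\int[@lebesgue_rV R n]_(x in Omega) h x t + a).

Let mu := @lebesgue_rV R n.

Let mO : measurable Omega. Proof. exact: open_rV_measurable. Qed.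

Let bounded_on (f : 'rV[R]_n -> R -> R) (T : R) :
  {within closure Omega `*` `[0, +oo[,
    continuous (fun z : 'rV[R]_n * R => f z.1 z.2)} ->
  exists2 M, 0 <= M & forall x t, Omega x -> 0 <= t <= T -> `|f x t| <= M.
Proof.
move=> cf; have cpt : compact (closure Omega `*` `[0, T]%classic).
  apply: compact_setX; last exact: segment_compact.
  by apply: bounded_closed_compact; [exact: bounded_closure|exact: closed_closure].
have cf' : {within closure Omega `*` `[0, T], continuous (fun z => f z.1 z.2)}.
  apply: continuous_subspaceW cf => -[x t] [/= Ox]; rewrite !in_itv/=.
  by move=> /andP[t0 _]; split=> //=; rewrite andbT.
have [M fM] := compact_continuous_bounded cpt cf'.
exists `|M| => // x t Ox t0T; apply: (le_trans _ (ler_norm M)).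
by apply: (fM (x, t)); split=> /=; [exact: subset_closure|rewrite in_itv].
Qed.

Lemma within_continuous_fix_time (f : 'rV[R]_n -> R -> R) (t : R) : 0 <= t ->
  {within closure Omega `*` `[0, +oo[,
    continuous (fun z : 'rV[R]_n * R => f z.1 z.2)} ->
  {within closure Omega, continuous (f ^~ t)}.
Proof.
move=> t0 cf; have := @continuous_within_comp 'rV[R]_n ('rV[R]_n * R)%type R (closure Omega)
  (closure Omega `*` `[0, +oo[) (fun x => (x, t)) (fun z => f z.1 z.2) _ _ cf.
apply.
  apply: continuous_subspaceT => x P [[A B] [/= Ax Bt] AB].
  by apply: filterS Ax => y Ay; apply: AB; split => //=; exact: nbhs_singleton.
by move=> x Ox; split => //=; rewrite in_itv/= t0.
Qed.

Let int_h (t : R) : 0 <= t -> mu.-integrable Omega (EFin \o (h ^~ t)).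
Proof.
by move=> t0; apply: closure_continuous_integrable => //;
  exact: (within_continuous_fix_time t0 ch).
Qed.

Let int_cst (c : R) : mu.-integrable Omega (EFin \o cst c).
Proof.
apply: (@le_bounded_integrable _ _ _ _ _ _ `|c|) => //.
exact: bounded_rV_measure_lty.
Qed.

(* The even extension in time makes 0 an interior point. *)
Let E (s : R) := \int[mu]_(x in Omega) h x `|s|.

(** Dominated convergence, with a constant bound supplied by compactness. Continuity at 0 lets the
    Gronwall argument start at the initial time. *)
Let E_continuous (T : R) : {in `]- T, T[, continuous E}.
Proof.
have [M M0 hM] := bounded_on T ch.
move=> s sT; apply: (@continuity_under_integral R _ _ mu (fun (s : R) x => h x `|s|)
  Omega mO (- T) T _ _ (cst M) _ _ s); last by rewrite inE.
- by move=> r _; exact: int_h.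
- apply: aeW => x Ox r _.
  suff H : {within setT, continuous (fun r : R => h x `|r|)}.
    exact: ((continuous_subspace_setT _).2 H r).
  apply: (@continuous_within_comp R ('rV[R]_n * R)%type R setT (closure Omega `*` `[0, +oo[)
    (fun r : R => (x, `|r|)) (fun z => h z.1 z.2)) => //; last first.
    move=> r' _; split => /=; first exact: subset_closure.
    by rewrite in_itv/= normr_ge0.
  apply: continuous_subspaceT => r' P [[A B] [/= Ax Br] AB].
  have Br1 : \forall y \near r', B `|y| by exact: norm_continuous Br.
  apply: filterS Br1 => y By.
  by apply: AB; split; [exact: (nbhs_singleton Ax)|exact: By].
- exact: int_cst.
- move=> r rT; apply: aeW => x Ox; apply: hM => //.
  by rewrite normr_ge0/= ler_norml; move: rT; rewrite /= in_itv/= => /andP[/ltW-> /ltW->].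
Qed.

(** Differentiation under the integral on $]0,s+1[$, dominated by a bound for [g] on the compact
    time interval. *)
Let E_derive (s : R) : 0 < s ->
  is_derive s 1 E (\int[mu]_(x in Omega) g x s).
Proof.
move=> s0; pose T := s + 1.
have sT : s \in `]0, T[ by rewrite in_itv/= s0 ltrDl ltr01.
have [M M0 gM] := bounded_on T cg.
have d1 (r : R) x : 0 < r -> Omega x -> partial1of2 (fun (s : R) x => h x s) r x = g x r.
  by move=> r0 Ox; rewrite partial1of2E; have [_] := dh Ox r0.
have : is_derive s 1 (fun s => \int[mu]_(x in Omega) h x s)
    (\int[mu]_(x in Omega) g x s).
  have hint r : `]0, T[%classic r -> mu.-integrable Omega (EFin \o (h ^~ r)).
    by rewrite /= in_itv/= => /andP[/ltW r0 _]; exact: int_h.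
  have hder (r : R) x : `]0, T[%classic r -> Omega x -> derivable (h x) r 1.
    by rewrite /= in_itv/= => /andP[r0 _] Ox; have [] := dh Ox r0.
  have hub (r : R) x : `]0, T[%classic r -> Omega x ->
      `|partial1of2 (fun (s : R) x => h x s) r x| <= M.
    rewrite /= in_itv/= => /andP[r0 /ltW rT] Ox; rewrite d1//.
    by apply: gM; rewrite ?(ltW r0).
  split.
    exact: (@derivable_under_integral R _ _ mu (fun (s : R) x => h x s) Omega mO s 0 T
      sT hint hder (cst M) (fun=> M0) (int_cst M) hub).
  rewrite -derive1E.
  rewrite (@differentiation_under_integral R _ _ mu (fun (s : R) x => h x s) Omega mO
    s 0 T sT hint hder (cst M) (fun=> M0) (int_cst M) hub).
  by apply: eq_Rintegral => x /set_mem Ox; exact: d1.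
(* Near [s > 0] the even extension agrees with the integral itself. *)
apply: near_eq_is_derive; near=> r.
have r0 : 0 < r by near: r; exact: lt_nbhsr.
by rewrite /E ger0_norm// ltW.
Unshelve. all: by end_near. Qed.

(** With the integrating factor [expR (- C * s)], the function [k] is continuous on $[0,\infty[$ and
    has nonpositive derivative for [s > 0], hence is nonincreasing. *)
Lemma gronwall_Rintegral (t : R) : 0 <= t ->
  \int[mu]_(x in Omega) h x t + a <=
  (\int[mu]_(x in Omega) h x 0 + a) * expR (C * t).
Proof.
move=> t0; pose k s := expR (- C * s) * (E s + a).
have dk (s : R) : 0 < s -> is_derive s 1 k (expR (- C * s) *
    (\int[mu]_(x in Omega) g x s - C * (E s + a))).
  move=> s0; have dE := E_derive s0.
  have dEa : is_derive s 1 (fun s => E s + a) (\int[mu]_(x in Omega) g x s).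
    by apply: is_derive_eq; rewrite addr0.
  have de : is_derive s 1 (fun s => expR (- C * s)) (expR (- C * s) * - C).
    have dC : is_derive s 1 (fun s => - C * s) (- C).
      apply: (is_derive_eq (is_deriveZ (- C) (is_derive_id s 1))).
      by rewrite /GRing.scale/= mulr1.
    exact: is_derive1_comp.
  apply: (is_derive_eq (is_deriveM de dEa)); rewrite /GRing.scale/=; ring.
have : k t <= k 0.
  (* The right end [t + 1] keeps [t] inside the half-open interval. *)
  apply: (@ler0_derive1_le_co R k 0 (t + 1)).
  - by move=> s; rewrite in_itv/= => /andP[s0 _]; have [] := dk s s0.
  - move=> s; rewrite in_itv/= => /andP[s0 _]; rewrite derive1E.
    have [_ ->] := dk s s0; rewrite mulr_ge0_le0 ?expR_ge0// subr_le0.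
    by rewrite /E ger0_norm ?gC// ltW.
  - apply: (@continuous_subspaceW _ _ _ `](- (t + 1)), (t + 1)[).
      move=> s /=; rewrite !in_itv/= => /andP[s0 ->]; rewrite andbT.
      by apply: lt_le_trans s0; lra.
    rewrite continuous_open_subspace//.
    move=> s sT; apply: cvgM.
      apply: (@continuous_comp _ _ _ (fun s => - C * s) expR).
        by apply: cvgMr; exact: cvg_id.
      exact: continuous_expR.
    by apply: cvgD; [apply: E_continuous; exact: set_mem sT|exact: cvg_cst].
  - rewrite in_itv/=; lra.
  - rewrite in_itv/=; lra.
  - exact: t0.
rewrite /k /E normr0 mulr0 expR0 mul1r ger0_norm// mulNr expRN mulrC.
by rewrite ler_pdivrMr ?expR_gt0.
Qed.

End gronwall.

(** * The energy estimate *)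

(** For [x <= 1] the left side is at most [2 ^+ k], otherwise at most [(2 * x) ^+ k]. *)
Lemma exprD1_le (R : realFieldType) (x : R) (k : nat) : 0 <= x ->
  (x + 1) ^+ k <= 2 ^+ k * (x ^+ k + 1).
Proof.
move=> x0; have [x1|/ltW x1] := leP x 1.
  apply: (@le_trans _ _ (2 ^+ k)); first by rewrite lerXn2r ?nnegrE//; lra.
  by rewrite ler_peMr// ?exprn_ge0// lerDr exprn_ge0.
apply: (@le_trans _ _ ((2 * x) ^+ k)); first by rewrite lerXn2r ?nnegrE//; lra.
by rewrite exprMn ler_wpM2l ?exprn_ge0// lerDl.
Qed.

(** This bounds, up to a factor [p], the reaction part of the derivative of [H]. The head costs
    [C * (S + 1)], each remaining copy of [z] at most [C * S], and [S ^+ p] is at most the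
    energy. *)
Lemma wform_reaction_le (R : realType) m (theta : 'I_m -> R) (C : R) (p : nat)
    (F z : 'rV[R]_m) :
  (0 < p)%N -> 0 <= C -> (forall i, 1 <= theta i) ->
  (forall i, theta i ^+ (2 * p + 1) <= C) -> orthant z ->
  (forall b, (forall i, b i <= p)%N ->
    \sum_i weight theta b i * F ord0 i <= C * (\sum_i z ord0 i + 1)) ->
  wform theta (fun=> 0%N) (F :: nseq p.-1 z) <=
  (2 * C) ^+ p * (wform theta (fun=> 0%N) (nseq p z) + 1).
Proof.
move=> p0 C0 th1 thC z0 FC; set S := \sum_i z ord0 i in FC *.
have S0 : 0 <= S by apply: sumr_ge0 => i _; exact: z0.
have th0 i : 0 <= theta i by exact: le_trans (th1 i).
have zs k : {in nseq k z, forall y, orthant y} by move=> y /nseqP[->].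
apply: (@le_trans _ _ (C * (S + 1) * wform theta (fun=> 0%N) (nseq p.-1 z))).
  apply: le_wform_head FC _ => // i.
  by rewrite add0n size_nseq leq_pred.
apply: (@le_trans _ _ ((C * (S + 1)) ^+ p)).
  rewrite -[in leRHS](prednK p0) exprS; apply: ler_wpM2l.
    by rewrite mulr_ge0// addr_ge0.
  apply: (le_trans (@wform_nseq_le _ _ _ _ _ _ p C th1 thC z0 _)).
    by move=> i; rewrite add0n leq_pred.
  rewrite lerXn2r ?nnegrE ?mulr_ge0 ?addr_ge0// ler_wpM2l//.
  by rewrite lerDl.
rewrite !exprMn [2 ^+ p * _]mulrC -mulrA ler_wpM2l ?exprn_ge0//.
apply: (le_trans (exprD1_le p S0)); rewrite ler_wpM2l ?exprn_ge0//.
by rewrite lerD2r ge_wform_nseq.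
Qed.

(** On the orthant the cross terms in the square of the sum are nonnegative. *)
Lemma enorm_le_sum (R : realType) m (z : 'rV[R]_m) : orthant z ->
  enorm z <= \sum_i z ord0 i.
Proof.
move=> z0; have S0 : 0 <= \sum_i z ord0 i by apply: sumr_ge0 => i _; exact: z0.
rewrite -[leRHS]ger0_norm// -sqrtr_sqr ler_wsqrtr// expr2 big_distrl/=.
apply: ler_sum => i _; rewrite expr2 ler_wpM2l ?z0//.
by rewrite (bigD1 i)//= lerDl sumr_ge0// => j _; exact: z0.
Qed.

(** The integral of the [p]-th power of the norm is at most [B]. The bound [1 + B] avoids a root:
    its base is at least 1, so $(1+B)^{1/p}\le 1+B$. *)
Lemma Lp_norm_le (R : realType) n m (Omega : set 'rV[R]_n) (p : nat)
    (w : 'rV[R]_n -> 'rV[R]_m) (H : 'rV[R]_n -> R) (B : R) :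
  open Omega -> bounded_set Omega -> (0 < p)%N ->
  (forall i, {within closure Omega, continuous (fun x => w x ord0 i)}) ->
  (forall x, Omega x -> orthant (w x)) ->
  {within closure Omega, continuous H} ->
  (forall x, Omega x -> (\sum_i w x ord0 i) ^+ p <= H x) ->
  \int[@lebesgue_rV R n]_(x in Omega) H x <= B ->
  (Lp_norm Omega p w <= (1 + B)%:E)%E.
Proof.
move=> oO bO p0 cw w0 cH wH HB.
have mO : measurable Omega by exact: open_rV_measurable.
have iH := closure_continuous_integrable oO bO cH.
have e0 x : 0 <= enorm (w x) by exact: sqrtr_ge0.
have H0 x : Omega x -> 0 <= H x.
  move=> Ox; apply: le_trans (wH x Ox); rewrite exprn_ge0// sumr_ge0// => i _.
  exact: w0.
have B0 : 0 <= B by apply: le_trans HB; exact: Rintegral_ge0.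
have p0' : 0 < p%:R^-1 :> R by rewrite invr_gt0 ltr0n.
have mw : measurable_fun Omega (fun x => enorm (w x) ^+ p).
  apply: within_continuous_rV_measurable => //.
  apply: (continuous_subspaceW (@subset_closure _ _)) => x.
  apply: (@continuous_comp (subspace (closure Omega)) R R (fun x => enorm (w x)) (fun y => y ^+ p)).
    apply: (@continuous_comp (subspace (closure Omega)) R R (fun x => \sum_i w x ord0 i ^+ 2) Num.sqrt).
      apply: cvg_big => [|i _]; first exact: add_continuous.
      by rewrite expr2; apply: cvgM; exact: cw.
    exact: sqrt_continuous.
  exact: exprn_continuous.
have I_le : (\int[@lebesgue_rV R n]_(x in Omega) (enorm (w x) ^+ p)%:E <= B%:E)%E.
  apply: (@le_trans _ _ (\int[@lebesgue_rV R n]_(x in Omega) (H x)%:E)%E).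
    apply: ge0_le_integral => //.
    - by move=> x _; rewrite lee_fin exprn_ge0.
    - exact/measurable_EFinP.
    - exact: measurable_int iH.
    move=> x Ox; rewrite lee_fin; apply: le_trans (wH x Ox).
    rewrite lerXn2r ?nnegrE// ?enorm_le_sum//; last exact: w0.
    by rewrite sumr_ge0// => i _; exact: w0.
  rewrite -(fineK (integrable_fin_num mO iH)) lee_fin; exact: HB.
rewrite /Lp_norm unlock.
rewrite [X in (X `^ _)%E](_ : _ =
  \int[@lebesgue_rV R n]_(x in Omega) (enorm (w x) ^+ p)%:E)%E; last first.
  rewrite [RHS]integral_mkcond; apply: eq_integral => x _.
  rewrite !patchE; case: ifPn => _.
    by rewrite /= ger0_norm// powR_mulrn.
  (* Off [Omega] the restricted function is 0, and so is its [p]-th power because [p > 0]. *)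
  by rewrite /= normr0 powR_mulrn// expr0n gtn_eqF.
apply: (@le_trans _ _ ((1 + B)%:E `^ p%:R^-1)%E).
  apply: gt0_ler_poweR => //.
  - by rewrite in_itv/= leey andbT integral_ge0// => x _; rewrite lee_fin exprn_ge0.
  - by rewrite in_itv/= leey andbT lee_fin addr_ge0.
  - by apply: (le_trans I_le); rewrite lee_fin lerDr.
rewrite poweR_EFin lee_fin ler1_powR ?lerDl//.
by rewrite invf_le1 ?ltr0n// ler1n.
Qed.

Theorem lemma5p1 (R : realType) (n : nat) (hn : (2 <= n)%N)
  (Omega : set 'rV[R]_n) (hOmega : bounded_smooth_domain Omega)
  (m : nat) (hm : (2 <= m)%N)
  (d : 'I_m -> R) (hd : forall i, 0 < d i)
  (v : 'rV[R]_n -> 'rV[R]_m)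
  (hv : {within closure Omega, continuous v})
  (hv0 : forall x, closure Omega x -> orthant (v x))
  (f : 'rV[R]_m -> 'rV[R]_m)
  (hF : locally_lipschitz f)
  (hQP : quasi_positive f)
  (A : 'M[R]_m) (L : R) (hIS : intermediate_sums f A L)
  (p : nat) (hp : (2 <= p)%N) :
  exists Lp : R -> R,
    [/\ {within `[0, +oo[, continuous Lp},
        forall t, 0 <= t -> 0 <= Lp t &
        forall (phi : 'rV[R]_n -> 'rV[R]_n -> R) (eps mu : R),
          admissible_kernel Omega phi eps mu ->
        forall u : 'rV[R]_n -> R -> 'rV[R]_m,
          global_classical_solution Omega d phi f v u ->
          (forall x t, closure Omega x -> 0 <= t -> orthant (u x t)) ->
        forall t, 0 <= t ->
          (Lp_norm Omega p (fun x => u x t) <= (Lp t)%:E)%E].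
Proof.
have [neO oO _ bO _] := hOmega.
have p0 : (0 < p)%N by exact: leq_trans hp.
have mO : measurable Omega by exact: open_rV_measurable.
have muO : (lebesgue_rV Omega < +oo)%E by exact: bounded_rV_measure_lty.
have [theta [C [C0 th1 thC reac diff]]] := exists_weights p hd hIS.
have th0 i : 0 <= theta i by exact: le_trans (th1 i).
pose b0 : 'I_m -> nat := fun=> 0%N.
pose H (z : 'rV[R]_m) := wform theta b0 (nseq p z).
have H0 z : orthant z -> 0 <= H z.
  by move=> z0; apply: wform_ge0 => // y /nseqP[->].
pose mu := @lebesgue_rV R n.
pose a := fine (mu Omega).
have a0 : 0 <= a by rewrite fine_ge0.
(* The factor [p] comes from differentiating [H], the power from [wform_reaction_le]. *)
pose C1 := p%:R * (2 * C) ^+ p.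
have C1_ge0 : 0 <= C1 by rewrite !mulr_ge0 ?exprn_ge0 ?mulr_ge0.
pose E0 := \int[mu]_(x in Omega) H (v x).
have E0_ge0 : 0 <= E0.
  by apply: Rintegral_ge0 => x /subset_closure Ox; apply: H0; exact: hv0.
(* The Gronwall bound for the energy, with [1 +] from [Lp_norm_le]. The kernel and the solution are
   introduced only afterwards, so the bound cannot depend on them. *)
exists (fun t => 1 + (E0 + a) * expR (C1 * t)); split.
- apply: continuous_subspaceT => t; apply: cvgD; first exact: cvg_cst.
  apply: cvgMr; apply: (@continuous_comp _ _ _ (fun t => C1 * t) expR).
    by apply: cvgMr; exact: cvg_id.
  exact: continuous_expR.
- by move=> t _; rewrite addr_ge0// mulr_ge0 ?addr_ge0 ?expR_ge0.
move=> phi eps eta [cphi phi0 phiC _ _] u [ut [cu cut dut eqn init]] u0 t t0.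
pose h x s := H (u x s).
pose g x s := p%:R * wform theta b0 (ut x s :: nseq p.-1 (u x s)).
pose Q : set ('rV[R]_n * R) := closure Omega `*` `[0, +oo[.
have ch : {within closure Omega `*` `[0, +oo[,
    continuous (fun z : 'rV[R]_n * R => h z.1 z.2)}.
  exact: (@continuous_wform_nseq R m (subspace Q)
    theta b0 (fun z => u z.1 z.2) p cu).
have cg : {within closure Omega `*` `[0, +oo[,
    continuous (fun z : 'rV[R]_n * R => g z.1 z.2)}.
  move=> z; apply: cvgMr.
  apply: (@continuous_wform_cons R m (subspace Q)
    theta b0 (fun z => ut z.1 z.2) (fun z => nseq p.-1 (u z.1 z.2))) => //.
  move=> b.
  exact: (@continuous_wform_nseq R m (subspace Q)
    theta b (fun z => u z.1 z.2) p.-1 cu).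
have dh x (s : R) : Omega x -> 0 < s -> is_derive s 1 (h x) (g x s).
  move=> Ox s0; apply: is_derive_wform_nseq => i.
  apply: is_derive_ge0_is_derive => //; apply: dut; last exact: ltW.
  exact: subset_closure.
have cus i (s : R) : 0 <= s -> {within closure Omega, continuous (fun x => u x s ord0 i)}.
  by move=> s0; exact: (within_continuous_fix_time (f := fun x s => u x s ord0 i)).
have int_h (s : R) : 0 <= s -> mu.-integrable Omega (EFin \o (h ^~ s)).
  by move=> s0; apply: closure_continuous_integrable => //;
    exact: (within_continuous_fix_time (f := h)).
have int1 : mu.-integrable Omega (EFin \o cst 1).
  by apply: (@le_bounded_integrable _ _ _ _ _ _ `|1|).
have gC (s : R) : 0 < s -> \int[mu]_(x in Omega) g x s <=
    C1 * (\int[mu]_(x in Omega) h x s + a).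
  move=> /ltW s0.
  (* The diffusion part of [g] at time [s], without its factor [p]. *)
  pose W x := wform theta b0
    (nonlocal_diffusion Omega d phi (u^~ s) x :: nseq p.-1 (u x s)).
  have iW : mu.-integrable Omega (EFin \o W).
    by apply: integrable_wform_diffusion => // i; exact: cus.
  have W0 : \int[mu]_(x in Omega) W x <= 0.
    apply: Rintegral_wform_diffusion_le0 => //; first by move=> i; exact: cus.
    by move=> x Ox; exact: u0.
  have ih1 : mu.-integrable Omega (EFin \o (fun x => h x s + 1)).
    exact: (integrableD mO (int_h _ s0) int1).
  have ipW : mu.-integrable Omega (EFin \o (fun x => p%:R * W x)).
    exact: (integrableZl mO p%:R iW).
  have iCh : mu.-integrable Omega (EFin \o (fun x => C1 * (h x s + 1))).
    exact: (integrableZl mO C1 ih1).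
  (* Pointwise, the equation splits [ut] into diffusion and reaction. Linearity in the head isolates
     [W], and the reaction contributes at most [C1 * (h x s + 1)]. *)
  apply: (@le_trans _ _ (\int[mu]_(x in Omega) (p%:R * W x + C1 * (h x s + 1)))).
    apply: le_Rintegral => //.
    - apply: closure_continuous_integrable => //.
      exact: (within_continuous_fix_time (f := g)).
    - exact: (integrableD mO ipW iCh).
    move=> x Ox; have Oxc := subset_closure Ox.
    rewrite /g /C1 -mulrA -mulrDr; apply: ler_wpM2l => //.
    have -> : ut x s = nonlocal_diffusion Omega d phi (u^~ s) x + f (u x s).
      by apply/rowP => i; rewrite !mxE eqn.
    rewrite wformD lerD2l; apply: wform_reaction_le => //; first exact: u0.
    by move=> b bp; apply: reac => //; exact: u0.
  rewrite RintegralD// !RintegralZl// RintegralD//; last exact: int_h.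
  (* The constant 1 integrates to [a], the measure of [Omega]. *)
  rewrite Rintegral_cst// mul1r -[leRHS]add0r lerD2r.
  by rewrite mulr_ge0_le0.
have Et := gronwall_Rintegral oO bO ch cg dh gC t0.
have hE0 : \int[mu]_(x in Omega) h x 0 = E0.
  apply: eq_Rintegral => x /set_mem Ox; congr H.
  by apply/rowP => i; exact: init.
apply: (@Lp_norm_le R n m Omega p (u^~ t) (h^~ t)) => //.
- by move=> i; exact: cus.
- by move=> x /subset_closure Ox; exact: u0.
- exact: (within_continuous_fix_time (f := h)).
- move=> x /subset_closure Ox; apply: ge_wform_nseq => //; exact: u0.
(* As [a] is nonnegative, it may be dropped from the left side of Gronwall's inequality. *)
- by rewrite -hE0; apply: le_trans Et; rewrite lerDl.
Qed.
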